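(* Let $0<\gamma\le 5/9$, let $a<0$ and $b\in\mathbb{R}$, and let $\beta_1=a\beta_2+b$. Let $\widetilde F^{\ast}(\beta_2)$ be the set of maximizers in the reduced graphon space of the variational problem of the generalized edge-triangle exponential random graph model with parameters $(\beta_1,\beta_2)$ and exponent $\gamma$. Then $$\lim_{\beta_2\to-\infty}\ \sup_{\tilde f\in\widetilde F^{\ast}(\beta_2)}\delta_\square(\tilde f,\widetilde U)=0,$$ where $U\subset\mathcal W$ is given by: (i) $U=\{f^{K_2}\}$ if $a>-2$, or $a=-2$ and $b<0$; (ii) $U=\{f^{K_2},1\}$ if $a=-2$ and $b=0$; (iii) $U=\{1\}$ if $a<-2$, or $a=-2$ and $b>0$.
   Context: $\mathcal W$ is the set of symmetric measurable functions $f:[0,1]^2\to[0,1]$ (graphons). For a finite simple graph $H$, $t(H,f)=\int_{[0,1]^{V(H)}}\prod_{\{i,j\}\in E(H)}f(x_i,x_j)\prod_{k\in V(H)}dx_k$. The cut norm is $\|h\|_\square=\sup_{A,B\subset[0,1]}\left|\int_{A\times B}h(x,y)\,dx\,dy\right|$. The reduced graphon space $(\widetilde{\mathcal W},\delta_\square)$ is the quotient of $\mathcal W$ by zero cut distance, where $\delta_\square(\tilde f,\tilde g)=\inf_{\sigma,\tau}\|f_\sigma-g_\tau\|_\square$ over measure preserving bijections $\sigma,\tau$ of $[0,1]$, with $f_\sigma(x,y)=f(\sigma x,\sigma y)$. For $U\subset\mathcal W$, $\widetilde U$ is its image in $\widetilde{\mathcal W}$, and $\delta_\square(\tilde f,\widetilde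 U)=\inf_{\tilde u\in\widetilde U}\delta_\square(\tilde f,\tilde u)$. $K_m$ is the complete graph on $m$ vertices. The Turán graphon $f^{K_k}$ with $k$ classes ($k\ge2$) is $f^{K_k}(x,y)=0$ if $\lceil xk\rceil=\lceil yk\rceil$ and $1$ otherwise; $1$ denotes the constant graphon $1$. The generalized edge-triangle model is the probability measure on labeled simple graphs $G_n$ on $n$ vertices with probability proportional to $\exp\left(n^2(\beta_1t(K_2,G_n)+\beta_2t(K_3,G_n)^\gamma)\right)$. Let $I(u)=\tfrac12u\log u+\tfrac12(1-u)\log(1-u)$ on $[0,1]$ (with $0\log0=0$) and $I(\tilde f)=\int_0^1\int_0^1I(f(x,y))\,dx\,dy$. The variational problem is $$\sup_{\tilde f\in\widetilde{\mathcal W}}\left\{\beta_1t(K_2,\tilde f)+\beta_2t(K_3,\tilde f)^\gamma-I(\tilde f)\right\},$$ and $\widetilde F^{\ast}(\beta_2)\subset\widetilde{\mathcal W}$ is the (nonempty) set where this supremum is attained, with $\beta_1=a\beta_2+b$. *)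

(* Defs.v *)
From HB Require Import structures.
From mathcomp Require Import all_boot all_order all_algebra.
From mathcomp Require Import all_classical all_reals all_analysis.
From mathcomp Require Import measurable_realfun.
Set Implicit Arguments.
Unset Strict Implicit.
Unset Printing Implicit Defensive.
Import Order.TTheory GRing.Theory Num.Theory.
Import numFieldNormedType.Exports.
Local Open Scope classical_set_scope.
Local Open Scope ring_scope.
Local Open Scope quotient_scope.

Section Graphons.
Context (R : realType).
(* The measurable type carrying [lebesgue_measure]; it is R with its Borel sets. *)
Local Notation RT := (measurableTypeR R).
Implicit Types (f g h : RT * RT -> R) (s t : RT -> RT) (A B : set RT).

Local Notation mu := (@lebesgue_measure R).
Local Notation mu2 := (mu \x mu)%E.

Definition unit_itv : set RT := `[0, 1].
Local Notation U := unit_itv.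
Definition unit_sq : set (RT * RT) := U `*` U.

(* Values outside the unit square are irrelevant: every notion below only
   looks at the restriction to the unit square. *)
Definition is_graphon f :=
  [/\ measurable_fun unit_sq f,
      forall x y, U x -> U y -> f (x, y) = f (y, x) &
      forall x y, U x -> U y -> 0 <= f (x, y) <= 1].

Record graphon := Graphon {
  graphon_fun :> RT * RT -> R;
  graphonP : is_graphon graphon_fun }.

HB.instance Definition _ := gen_eqMixin graphon.
HB.instance Definition _ := gen_choiceMixin graphon.

Definition cut_vals h := [set r | exists A B,
  [/\ measurable A, measurable B, A `<=` U, B `<=` U
    & r = `| \int[mu2]_(z in A `*` B) h z |]].

Definition cut_norm h : R := sup (cut_vals h).

(* [measurable] is Borel on R, so the third clause (measurability of the
   inverse) holds automatically for a Borel bijection, by Lusin-Souslin. *)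
Definition mp_bij s :=
  [/\ set_bij U U s,
      measurable_fun U s,
      forall A, measurable A -> A `<=` U -> measurable (s @` A) &
      forall A, measurable A -> A `<=` U -> mu (U `&` s @^-1` A) = mu A].

Definition relabel s f : RT * RT -> R := fun z => f (s z.1, s z.2).

Definition cut_dist_vals (f g : graphon) := [set r | exists s t,
  [/\ mp_bij s, mp_bij t & r = cut_norm (relabel s f \- relabel t g)]].

Definition cut_dist (f g : graphon) : R := inf (cut_dist_vals f g).

Lemma mU : measurable U.
Proof. exact: measurable_itv. Qed.

Lemma munit_sq : measurable unit_sq.
Proof. by apply: measurableX; exact: mU. Qed.

Lemma muU : mu U = 1%E.
Proof. by rewrite /unit_itv lebesgue_measure_itv/= lte01 EFinN sube0. Qed.

Lemma mu2_rect_le1 A B : measurable A -> measurable B -> A `<=` U -> B `<=` U ->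
  (mu2 (A `*` B) <= 1)%E.
Proof.
move=> mA mB AU BU; rewrite product_measure1E//.
rewrite -[leRHS]mule1 -{1}muU -muU.
by apply: lee_pmul => //; apply: le_measure => //; rewrite ?inE//; exact: mU.
Qed.

(* Bounded measurable functions on the unit square. *)
Definition bmfun h := measurable_fun unit_sq h /\
  exists M, forall x y, U x -> U y -> `|h (x, y)| <= M.

Lemma bmfunB f g : bmfun f -> bmfun g -> bmfun (f \- g).
Proof.
move=> [mf [M fM]] [mg [N gN]]; split; first exact: measurable_funB.
exists (M + N) => x y Ux Uy /=; rewrite (le_trans (ler_normB _ _))// lerD//.
  exact: fM.
exact: gN.
Qed.

Lemma graphon_bmfun f : is_graphon f -> bmfun f.
Proof.
move=> [mf _ f01]; split=> //; exists 1 => x y Ux Uy.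
by have /andP[f0 f1] := f01 _ _ Ux Uy; rewrite ger0_norm.
Qed.

Lemma bmfun_integrable h A B : bmfun h ->
  measurable A -> measurable B -> A `<=` U -> B `<=` U ->
  mu2.-integrable (A `*` B) (EFin \o h).
Proof.
move=> [mh [M hM]] mA mB AU BU.
have mAB : measurable (A `*` B) by exact: measurableX.
apply: measurable_bounded_integrable => //.
- by rewrite (le_lt_trans (mu2_rect_le1 mA mB AU BU))// ltry.
- apply: measurable_funS mh; first exact: munit_sq.
  by move=> z [? ?]; split; [exact: AU|exact: BU].
- exists M; split; first exact: num_real.
  move=> N MN [x y] [/= Ax By]; apply: ltW; apply: le_lt_trans MN.
  by apply: hM; [exact: AU|exact: BU].
Qed.

Lemma cut_vals_has_sup h : bmfun h -> has_sup (cut_vals h).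
Proof.
move=> bh; split; first by exists `| \int[mu2]_(z in set0 `*` set0) h z |,
  set0, set0; split.
case: (bh) => mh [M hM]; exists `|M| => _ [A [B [mA mB AU BU ->]]].
have mAB : measurable (A `*` B) by exact: measurableX.
have ih := bmfun_integrable bh mA mB AU BU.
have AB1 := mu2_rect_le1 mA mB AU BU.
have ABfin : mu2 (A `*` B) \is a fin_num.
  by rewrite ge0_fin_numE// (le_lt_trans AB1)// ltry.
have bM : bmfun (cst `|M|) by split=> //; exists `|M| => ? ? _ _; rewrite normr_id.
have := le_normr_Rintegral mAB ih.
move=> /le_trans; apply.
apply: (@le_trans _ _ (\int[mu2]_(z in A `*` B) `|M|)).
  apply: le_Rintegral => //.
  - exact: (integrable_abse ih).
  - exact: (bmfun_integrable bM).
  - move=> [x y] [/= Ax By]; apply: le_trans (ler_norm M).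
    by apply: hM; [exact: AU|exact: BU].
rewrite Rintegral_cst// ler_piMr//.
by rewrite -lee_fin fineK.
Qed.

Lemma cut_norm_ub h A B : bmfun h ->
  measurable A -> measurable B -> A `<=` U -> B `<=` U ->
  `| \int[mu2]_(z in A `*` B) h z | <= cut_norm h.
Proof.
move=> bh mA mB AU BU; apply: sup_upper_bound; first exact: cut_vals_has_sup.
by exists A, B.
Qed.

Lemma cut_norm_le h (M : R) : bmfun h ->
  (forall A B, measurable A -> measurable B -> A `<=` U -> B `<=` U ->
    `| \int[mu2]_(z in A `*` B) h z | <= M) ->
  cut_norm h <= M.
Proof.
move=> bh hM; apply: ge_sup; first by case: (cut_vals_has_sup bh).
by move=> _ [A [B [mA mB AU BU ->]]]; exact: hM.
Qed.

Lemma cut_norm_ge0 h : bmfun h -> 0 <= cut_norm h.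
Proof.
move=> bh; apply: le_trans (cut_norm_ub bh measurable0 measurable0 _ _) => //;
  exact: sub0set.
Qed.

Lemma eq_cut_norm h1 h2 : (forall x y, U x -> U y -> h1 (x, y) = h2 (x, y)) ->
  cut_norm h1 = cut_norm h2.
Proof.
move=> h12; congr sup; apply/seteqP; split=> _ [A [B [mA mB AU BU ->]]];
  exists A, B; split=> //; congr (`| _ |); apply: eq_Rintegral => -[x y];
  by rewrite inE => -[/= Ax By]; rewrite h12//; [exact: AU|exact: BU].
Qed.

Lemma cut_normB_sym f g : bmfun f -> bmfun g ->
  cut_norm (f \- g) = cut_norm (g \- f).
Proof.
move=> bf bg; congr sup; apply/seteqP; split=> _ [A [B [mA mB AU BU ->]]];
  exists A, B; split=> //; have mAB : measurable (A `*` B) by [exact: measurableX];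
  have If := bmfun_integrable bf mA mB AU BU;
  have Ig := bmfun_integrable bg mA mB AU BU;
  by rewrite (RintegralB mAB If Ig) (RintegralB mAB Ig If) distrC.
Qed.

Lemma cut_norm_triangle f g h : bmfun f -> bmfun g -> bmfun h ->
  cut_norm (f \- h) <= cut_norm (f \- g) + cut_norm (g \- h).
Proof.
move=> bf bg bh; apply: cut_norm_le; first exact: bmfunB.
move=> A B mA mB AU BU.
have mAB : measurable (A `*` B) by exact: measurableX.
have fgAB := cut_norm_ub (bmfunB bf bg) mA mB AU BU.
have ghAB := cut_norm_ub (bmfunB bg bh) mA mB AU BU.
apply: le_trans (lerD fgAB ghAB).
have If := bmfun_integrable bf mA mB AU BU.
have Ig := bmfun_integrable bg mA mB AU BU.
have Ih := bmfun_integrable bh mA mB AU BU.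
rewrite (RintegralB mAB If Ig) (RintegralB mAB Ig Ih) (RintegralB mAB If Ih).
exact: ler_distD.
Qed.

Lemma mp_bij_id : mp_bij id.
Proof.
split=> //.
- by split=> // x Ux; exists x.
- by move=> A mA _; rewrite image_id.
- by move=> A mA AU; rewrite preimage_id setIC (setIidl AU).
Qed.

Lemma mp_bijU s x : mp_bij s -> U x -> U (s x).
Proof. by move=> [[/(_ x)]]. Qed.

Lemma mp_bij_comp s t : mp_bij s -> mp_bij t -> mp_bij (s \o t).
Proof.
move=> [bs ms ims ps] bt'; have [bt mt imt pt] := bt'; split.
- exact: set_bij_comp bt bs.
- apply: (measurable_comp mU) => //.
  by move=> _ [x Ux <-]; exact: mp_bijU bt' Ux.
- move=> A mA AU; rewrite -image_comp; apply: ims; first exact: imt.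
  by move=> _ [x /AU Ux <-]; exact: mp_bijU bt' Ux.
- move=> A mA AU; rewrite -(ps A)// -[RHS]pt; last 2 first.
  - exact: ms mU _ mA.
  - exact: subIsetl.
  congr (mu _); apply/seteqP; split=> x /=; last by case=> ? [].
  by move=> [Ux sA]; split=> //; split=> //; exact: mp_bijU bt' Ux.
Qed.

Lemma mp_bij_inv s : mp_bij s ->
  exists2 t, mp_bij t & forall x, U x -> s (t x) = x.
Proof.
move=> bs'; have [[fs is_ ss] ms ims ps] := bs'.
pose t y := xget 0 [set x | U x /\ s x = y].
have tP y : U y -> U (t y) /\ s (t y) = y.
  move=> Uy; have [x Ux xy] := ss _ Uy.
  exact: (@xgetPex _ 0 [set x | U x /\ s x = y] (ex_intro _ x (conj Ux xy))).
have st x : U x -> t (s x) = x.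
  move=> Ux; have [Ut e] := tP _ (mp_bijU bs' Ux).
  by apply: is_ => //; rewrite inE.
have tpre A : U `&` t @^-1` A = s @` (A `&` U).
  apply/seteqP; split=> y /=.
    by move=> [Uy tA]; have [Ut e] := tP _ Uy; exists (t y).
  by move=> [x [Ax Ux] <-]; split; [exact: mp_bijU bs' Ux|rewrite /= st].
have timg A : A `<=` U -> t @` A = U `&` s @^-1` A.
  move=> AU; apply/seteqP; split=> y /=.
    by move=> [x Ax <-]; have [Ut e] := tP _ (AU _ Ax); split=> //; rewrite /= e.
  by move=> [Uy sA]; exists (s y) => //; exact: st.
exists t; last by move=> x /tP[].
split.
- split.
  + by move=> x /tP[].
  + move=> x y; rewrite !inE => Ux Uy txy.
    by rewrite -(tP _ Ux).2 txy (tP _ Uy).2.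
  + by move=> x Ux; exists (s x); [exact: mp_bijU bs' Ux|exact: st].
- move=> _ A mA; rewrite tpre; apply: ims; last exact: subIsetr.
  by apply: measurableI => //; exact: mU.
- by move=> A mA AU; rewrite timg//; apply: ms => //; exact: mU.
- move=> A mA AU; rewrite tpre (setIidl AU) -(ps (s @` A)).
  + congr (mu _); apply/seteqP; split=> x /=.
      by move=> [Ux [y Ay /is_ <-//]]; rewrite inE//; exact: AU.
    by move=> Ax; split; [exact: AU|exists x].
  + exact: ims.
  + by move=> _ [x /AU Ux <-]; exact: mp_bijU bs' Ux.
Qed.

(* Extension of a bijection of [0, 1] by the identity. *)
Definition mp_ext s : RT -> RT := fun x => if x \in U then s x else x.

Lemma mp_extE s x : U x -> mp_ext s x = s x.
Proof. by move=> Ux; rewrite /mp_ext mem_set. Qed.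

Lemma mp_ext_out s x : ~ U x -> mp_ext s x = x.
Proof. by move=> Ux; rewrite /mp_ext memNset. Qed.

Lemma mp_ext_preimage s A : mp_bij s ->
  mp_ext s @^-1` A = (U `&` s @^-1` (A `&` U)) `|` (A `\` U).
Proof.
move=> bs; apply/seteqP; split=> x /=.
  have [Ux|Ux] := pselect (U x).
    by rewrite mp_extE// => sX; left; split=> //; split=> //; exact: mp_bijU Ux.
  by rewrite mp_ext_out// => Xx; right.
by move=> [[Ux [sX _]]|[Xx NUx]]; [rewrite mp_extE|rewrite mp_ext_out].
Qed.

Lemma measurable_mp_ext s : mp_bij s -> measurable_fun setT (mp_ext s).
Proof.
move=> bs; have [_ ms _ _] := bs.
move=> _ X mX; rewrite setTI mp_ext_preimage//; apply: measurableU.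
  by apply: ms; [exact: mU|apply: measurableI => //; exact: mU].
by apply: measurableD => //; exact: mU.
Qed.

Lemma mu_mp_ext s A : mp_bij s -> measurable A -> mu (mp_ext s @^-1` A) = mu A.
Proof.
move=> bs mA; have [_ ms _ ps] := bs.
have mAU : measurable (A `&` U) by apply: measurableI => //; exact: mU.
have mAD : measurable (A `\` U) by apply: measurableD => //; exact: mU.
have mpre : measurable (U `&` s @^-1` (A `&` U)) by apply: ms => //; exact: mU.
have -> : mu A = (mu (A `&` U) + mu (A `\` U))%E.
  rewrite -[in LHS](setUIDK A U); apply: measureU => //.
  by apply/seteqP; split=> // x [[_ Ux] [_]].
rewrite -(ps (A `&` U)) ?mp_ext_preimage//; apply: measureU => //.
by apply/seteqP; split=> // x [[Ux _] [_]].
Qed.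

Definition mp_ext2 s (z : RT * RT) := (mp_ext s z.1, mp_ext s z.2).

Lemma measurable_mp_ext2 s : mp_bij s -> measurable_fun setT (mp_ext2 s).
Proof.
move=> bs; apply: measurable_fun_pair;
  by apply: (measurableT_comp (measurable_mp_ext bs)).
Qed.

Lemma mu2_mp_ext2 s (X : set (RT * RT)) : mp_bij s -> measurable X ->
  mu2 (mp_ext2 s @^-1` X) = mu2 X.
Proof.
move=> bs mX; have mS := measurable_mp_ext2 bs.
have mext := measurable_mp_ext bs.
pose m' := measure_function_pushforward__canonical__measure_function_Measure mu2 mS.
suff /(_ X mX) -> : forall Y : set (RT * RT), measurable Y -> mu2 Y = m' Y.
  exact: erefl.
apply: (@product_measure_unique _ _ RT RT R mu mu m') => A1 B1 mA1 mB1.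
rewrite /m' /= /pushforward.
have -> : mp_ext2 s @^-1` (A1 `*` B1) =
  (mp_ext s @^-1` A1) `*` (mp_ext s @^-1` B1) by [].
have mpA1 : measurable (mp_ext s @^-1` A1) by rewrite -[_ @^-1` _]setTI; exact: mext.
have mpB1 : measurable (mp_ext s @^-1` B1) by rewrite -[_ @^-1` _]setTI; exact: mext.
rewrite (product_measure1E mu mu mpA1 mpB1).
by congr (_ * _)%E; exact: mu_mp_ext.
Qed.

Lemma patch_sq h z : unit_sq z -> (h \_ unit_sq) z = h z.
Proof. by move=> Uz; rewrite patchT// inE. Qed.

Lemma relabel_ext s h x y : mp_bij s -> U x -> U y ->
  (h \_ unit_sq) (mp_ext2 s (x, y)) = relabel s h (x, y).
Proof.
move=> bs Ux Uy; rewrite /mp_ext2 /= !mp_extE// patchE mem_set//.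
by split; exact: mp_bijU.
Qed.

Lemma measurable_ext h : measurable_fun unit_sq h ->
  measurable_fun setT (h \_ unit_sq).
Proof. by move/(measurable_restrictT _ munit_sq). Qed.

Lemma relabel_measurable s f : mp_bij s -> measurable_fun unit_sq f ->
  measurable_fun unit_sq (relabel s f).
Proof.
move=> bs mf.
apply: (@eq_measurable_fun _ _ _ _ _ ((f \_ unit_sq) \o mp_ext2 s)).
  by move=> [x y]; rewrite inE => -[/= Ux Uy]; exact: relabel_ext.
apply: measurable_funTS; apply: measurableT_comp (measurable_mp_ext2 bs).
exact: measurable_ext.
Qed.

Lemma relabel_graphon s f : mp_bij s -> is_graphon f -> is_graphon (relabel s f).
Proof.
move=> bs [mf symf f01]; split; first exact: relabel_measurable.
- by move=> x y Ux Uy; apply: symf; exact: mp_bijU.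
- by move=> x y Ux Uy; apply: f01; exact: mp_bijU.
Qed.

Lemma relabel_bmfun s h : mp_bij s -> bmfun h -> bmfun (relabel s h).
Proof.
move=> bs [mh [M hM]]; split; first exact: relabel_measurable.
by exists M => x y Ux Uy; apply: hM; exact: mp_bijU.
Qed.

Lemma Rintegral_relabel s h A B : mp_bij s -> bmfun h ->
  measurable A -> measurable B -> A `<=` U -> B `<=` U ->
  \int[mu2]_(z in A `*` B) relabel s h z =
  \int[mu2]_(z in (s @` A) `*` (s @` B)) h z.
Proof.
move=> bs bh mA mB AU BU; have [[fs is_ _] ms ims ps] := bs.
have sAU : s @` A `<=` U by move=> _ [x /AU Ux <-]; exact: mp_bijU Ux.
have sBU : s @` B `<=` U by move=> _ [x /BU Ux <-]; exact: mp_bijU Ux.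
have msA : measurable (s @` A) by exact: ims.
have msB : measurable (s @` B) by exact: ims.
have mAB : measurable (A `*` B) by exact: measurableX.
have mext := measurable_mp_ext bs.
have preK X : X `<=` U -> mp_ext s @^-1` (s @` X) = X.
  move=> XU; apply/seteqP; split=> x /=.
    have [Ux|Ux] := pselect (U x).
      rewrite mp_extE// => -[y Xy syx].
      by rewrite -(is_ _ _ _ _ syx) ?inE//; exact: XU.
    rewrite mp_ext_out// => -[y Xy yx]; exfalso; apply: Ux; rewrite -yx.
    exact: mp_bijU (XU _ Xy).
  by move=> Xx; rewrite mp_extE; [exists x|exact: XU].
have Spre : mp_ext2 s @^-1` ((s @` A) `*` (s @` B)) = A `*` B.
  by rewrite -[in RHS](preK A)// -[in RHS](preK B).
pose F := h \_ unit_sq.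
have mF : measurable_fun setT (EFin \o F).
  by apply/measurable_EFinP; apply: measurable_ext; case: bh.
have FE : {in A `*` B, EFin \o relabel s h =1 (EFin \o F) \o mp_ext2 s}.
  move=> [x y]; rewrite inE => -[/= Ax By].
  by congr EFin; apply/esym; apply: relabel_ext => //; [exact: AU|exact: BU].
have intF : mu2.-integrable (mp_ext2 s @^-1` ((s @` A) `*` (s @` B)))
    ((EFin \o F) \o mp_ext2 s).
  rewrite Spre; apply: eq_integrable FE _ => //.
  by apply: bmfun_integrable => //; exact: relabel_bmfun.
have := integral_pushforward (measurable_mp_ext2 bs) mF intF
  (measurableX msA msB).
rewrite Spre => pushE.
rewrite /Rintegral; congr fine.
rewrite (eq_integral _ _ FE) -pushE.
transitivity (\int[mu2]_(z in (s @` A) `*` (s @` B)) (F z)%:E)%E.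
  apply: eq_measure_integral; first exact: measurable_mp_ext2.
  by move=> mS X mX _; exact: mu2_mp_ext2.
apply: eq_integral => -[x y]; rewrite inE => -[/= /sAU Ux /sBU Uy].
have Uxy : unit_sq (x, y) by split.
exact: (congr1 EFin (patch_sq h Uxy)).
Qed.

Lemma cut_norm_relabel s h : mp_bij s -> bmfun h ->
  cut_norm (relabel s h) <= cut_norm h.
Proof.
move=> bs bh; have [_ _ ims _] := bs.
apply: cut_norm_le; first exact: relabel_bmfun.
move=> A B mA mB AU BU; rewrite Rintegral_relabel//.
apply: cut_norm_ub => //.
- exact: ims.
- exact: ims.
- by move=> _ [x /AU Ux <-]; exact: mp_bijU Ux.
- by move=> _ [x /BU Ux <-]; exact: mp_bijU Ux.
Qed.

Lemma relabel_graphon_bmfun s (f : graphon) : mp_bij s -> bmfun (relabel s f).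
Proof.
by move=> bs; apply/graphon_bmfun/relabel_graphon => //; exact: graphonP.
Qed.

Lemma cut_dist_vals_has_inf (f g : graphon) :
  has_inf (cut_dist_vals f g).
Proof.
split.
  by exists (cut_norm (relabel id f \- relabel id g)), id, id; split=> //;
    exact: mp_bij_id.
exists 0 => _ [s [t [bs bt ->]]]; apply: cut_norm_ge0.
by apply: bmfunB; exact: relabel_graphon_bmfun.
Qed.

Lemma cut_dist_le (f g : graphon) s t : mp_bij s -> mp_bij t ->
  cut_dist f g <= cut_norm (relabel s f \- relabel t g).
Proof.
move=> bs bt; apply: ge_inf; last by exists s, t.
by case: (cut_dist_vals_has_inf f g).
Qed.

Lemma cut_dist_ge0 (f g : graphon) : 0 <= cut_dist f g.
Proof.
apply: lb_le_inf; first by case: (cut_dist_vals_has_inf f g).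
move=> _ [s [t [bs bt ->]]]; apply: cut_norm_ge0.
by apply: bmfunB; exact: relabel_graphon_bmfun.
Qed.

Lemma cut_dist_refl (f : graphon) : cut_dist f f = 0.
Proof.
apply/eqP; rewrite eq_le cut_dist_ge0 andbT.
apply: le_trans (cut_dist_le f f mp_bij_id mp_bij_id) _.
have bf : bmfun (relabel id f).
  by apply: relabel_graphon_bmfun; exact: mp_bij_id.
apply: cut_norm_le; first exact: bmfunB.
move=> A B mA mB AU BU; rewrite RintegralB ?subrr ?normr0//.
- exact: measurableX.
- exact: bmfun_integrable.
- exact: bmfun_integrable.
Qed.

Lemma cut_dist_sym (f g : graphon) : cut_dist f g = cut_dist g f.
Proof.
congr inf; apply/seteqP; split=> _ [s [t [bs bt ->]]]; exists t, s; split=> //;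
  by apply: cut_normB_sym; exact: relabel_graphon_bmfun.
Qed.

Lemma cut_dist_triangle (f g h : graphon) :
  cut_dist f h <= cut_dist f g + cut_dist g h.
Proof.
apply/ler_addgt0Pr => e e0; have e20 : 0 < e / 2 by rewrite divr_gt0.
have [_ [s [t [bs bt ->]]] ste] :=
  inf_adherent e20 (cut_dist_vals_has_inf f g).
have [_ [s' [t' [bs' bt' ->]]] ste'] :=
  inf_adherent e20 (cut_dist_vals_has_inf g h).
have [t1 bt1 tt1] := mp_bij_inv bt.
have br : mp_bij (t1 \o s') by exact: mp_bij_comp.
apply: le_trans (cut_dist_le f h (mp_bij_comp bs br) bt') _.
rewrite [X in _ + X](splitr e) addrACA.
apply: le_trans (lerD (ltW ste) (ltW ste')).
apply: le_trans (cut_norm_triangle (g := relabel s' g) _ _ _) _;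
  try by apply: relabel_graphon_bmfun => //; exact: mp_bij_comp.
rewrite lerD2r.
apply: le_trans (cut_norm_relabel br _); last first.
  by apply: bmfunB; exact: relabel_graphon_bmfun.
rewrite le_eqVlt; apply/orP; left; apply/eqP; apply: eq_cut_norm => x y Ux Uy.
by rewrite /relabel /= !tt1//; exact: mp_bijU.
Qed.

Definition cut_equiv (f g : graphon) : bool := cut_dist f g == 0.

Lemma cut_equiv_refl : reflexive cut_equiv.
Proof. by move=> f; rewrite /cut_equiv cut_dist_refl. Qed.

Lemma cut_equiv_sym : symmetric cut_equiv.
Proof. by move=> f g; rewrite /cut_equiv cut_dist_sym. Qed.

Lemma cut_equiv_trans : transitive cut_equiv.
Proof.
move=> g f h /eqP fg /eqP gh; rewrite /cut_equiv eq_le cut_dist_ge0 andbT.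
by rewrite (le_trans (cut_dist_triangle f g h))// fg gh addr0.
Qed.

Canonical cut_equiv_equiv :=
  EquivRel cut_equiv cut_equiv_refl cut_equiv_sym cut_equiv_trans.

Definition rgraphon := {eq_quot cut_equiv}.
HB.instance Definition _ := Quotient.on rgraphon.

Definition rcut_dist (x y : rgraphon) : R := cut_dist (repr x) (repr y).

Lemma cut_dist_pi (f g : graphon) :
  rcut_dist (\pi_rgraphon f) (\pi_rgraphon g) = cut_dist f g.
Proof.
have e k : cut_dist (repr (\pi_rgraphon k)) k = 0.
  have : repr (\pi_rgraphon k) = k %[mod rgraphon] by rewrite reprK.
  by move/eqmodP/eqP.
apply/eqP; rewrite eq_le; apply/andP; split.
  apply: le_trans (cut_dist_triangle _ f _) _; rewrite e add0r.
  by apply: le_trans (cut_dist_triangle _ g _) _; rewrite (cut_dist_sym g) e addr0.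
apply: le_trans (cut_dist_triangle _ (repr (\pi_rgraphon f)) _) _.
rewrite cut_dist_sym e add0r.
by apply: le_trans (cut_dist_triangle _ (repr (\pi_rgraphon g)) _) _;
  rewrite e addr0.
Qed.

Definition rcut_dist_set (x : rgraphon) (V : set rgraphon) : R :=
  inf [set rcut_dist x u | u in V].

Definition reduced (V : set graphon) : set rgraphon := \pi_rgraphon @` V.

Definition const1_fun : RT * RT -> R := cst 1.

Lemma const1_subproof : is_graphon const1_fun.
Proof.
split; [exact: measurable_cst | by [] |].
by move=> x y _ _; rewrite /const1_fun /= ler01 lexx.
Qed.

Definition const1 : graphon := Graphon const1_subproof.

Definition turan_fun (k : nat) : RT * RT -> R := fun z =>
  if Num.ceil ((z.1 : R) * k%:R) == Num.ceil ((z.2 : R) * k%:R) then 0 else 1.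

Lemma turan_subproof k : is_graphon (turan_fun k).
Proof.
split.
- pose c (x : RT) : R := (Num.ceil ((x : R) * k%:R))%:~R.
  have mc : measurable_fun setT c.
    apply: nondecreasing_measurable => // x y xy.
    by rewrite /c ler_int le_ceil// ler_wpM2r.
  apply: (eq_measurable_fun
      (fun z : RT * RT => if c z.1 == c z.2 then 0 else 1 : R)).
    by move=> z _; rewrite /turan_fun /c eqr_int.
  apply: measurable_funTS; apply: measurable_fun_ifT => //.
  by apply: measurable_fun_eqr; exact: (measurableT_comp mc).
- by move=> x y _ _; rewrite /turan_fun /= eq_sym.
- by move=> x y _ _; rewrite /turan_fun; case: ifP; rewrite !lexx ler01.
Qed.

Definition turan (k : nat) : graphon := Graphon (turan_subproof k).

(* Finite simple graphs, with vertices numbered 0, ..., n - 1. *)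
Record sgraph := SGraph {
  nverts : nat;
  adj : rel 'I_nverts;
  adj_sym : symmetric adj;
  adj_irr : irreflexive adj }.

Lemma complete_sym m : symmetric (fun i j : 'I_m => i != j).
Proof. by move=> i j; rewrite eq_sym. Qed.

Lemma complete_irr m : irreflexive (fun i j : 'I_m => i != j).
Proof. by move=> i; rewrite eqxx. Qed.

Definition complete (m : nat) : sgraph :=
  SGraph (@complete_sym m) (@complete_irr m).

(* Integral over [0, 1]^n as an iterated integral; for bounded measurable
   integrands this is the integral for the product measure, by Fubini. *)
Fixpoint cube_int (n : nat) : (n.-tuple RT -> R) -> R :=
  match n return (n.-tuple RT -> R) -> R with
  | 0 => fun F => F [tuple]
  | m.+1 => fun F =>
      \int[mu]_(x in U) cube_int (fun v : m.-tuple RT => F [tuple of x :: v])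
  end.

(* The condition e.1 < e.2 selects each unordered edge once. *)
Definition hom_density (H : sgraph) f : R :=
  cube_int (fun v : (nverts H).-tuple RT =>
    \prod_(e : 'I_(nverts H) * 'I_(nverts H) | (e.1 < e.2)%N && adj e.1 e.2)
      f (tnth v e.1, tnth v e.2)).

(* [ln 0 = 0] in the library, which agrees with the convention 0 log 0 = 0. *)
Definition rate (u : R) : R :=
  u * ln u / 2 + (1 - u) * ln (1 - u) / 2.

Definition graphon_rate f : R := \int[mu2]_(z in unit_sq) rate (f z).

(* Homomorphism densities and the rate are constant on classes for zero cut
   distance, so evaluating them at [repr x] involves no actual choice. *)
Definition objective (gamma beta1 beta2 : R) (x : rgraphon) : R :=
  beta1 * hom_density (complete 2) (repr x)
  + beta2 * (hom_density (complete 3) (repr x)) `^ gamma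
  - graphon_rate (repr x).

Definition maximizers (gamma beta1 beta2 : R) : set rgraphon :=
  [set x | objective gamma beta1 beta2 x
           = sup (range (objective gamma beta1 beta2))].

(* sup over the maximizers of the cut distance to the image of V; these
   distances lie in [0, 1], so the real supremum is the intended one. *)
Definition max_cut_dist (gamma beta1 beta2 : R) (V : set graphon) : R :=
  sup [set rcut_dist_set x (reduced V) | x in maximizers gamma beta1 beta2].

End Graphons.

Arguments const1 {R}.
Arguments turan {R} k.

(* Main.v *)
Require Import Defs.
From mathcomp Require Import all_boot all_order all_algebra.
From mathcomp Require Import all_classical all_reals all_analysis.
From mathcomp Require Import measurable_realfun perm ring lra.
Set Implicit Arguments.
Unset Strict Implicit.
Unset Printing Implicit Defensive.
Import Order.TTheory GRing.Theory Num.Theory.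
Import numFieldNormedType.Exports.
Local Open Scope classical_set_scope.
Local Open Scope ring_scope.

(** With N = -beta2, a maximizer f minimizes t(f)^gamma + a e(f) up to an error
    O(1/N), where e and t are the edge and triangle densities.  Goodman's bound
    t >= e (2 e - 1) and gamma <= 5/9 give t^gamma >= 2 e - 1 for e >= 1/2, with
    equality only at e = 1/2 and e = 1; hence e is close to 1, or e is close to
    1/2 and t is close to 0.  The sign of a + 2 selects one of the two regimes;
    when a = -2, comparing the O(1) terms b e - I at the two candidates does,
    since the entropy -I tends to 0 in both regimes.

    In the second regime f is close to a complete balanced bipartite graphon:
    for u = f(x, .), the integral over (y, z) of
      u(y) u(z) f(y, z) + (1 - u(y)) (1 - u(z)) f(y, z)
        + (u(y) + u(z) - 2 u(y) u(z)) (1 - f(y, z))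
    averages over x to at most 4 t + 3 e (1 - 2 e), so for some x the set
    A = {u >= 1/2} and its complement nearly bipartition f.  An exchange of
    small cells of [0, 1] moves A close to [0, 1/2). *)

(** * Integration of bounded measurable functions over the unit interval *)

Section UnitIntegral.
Context (R : realType).
Local Notation RT := (measurableTypeR R).
Local Notation mu := (@lebesgue_measure R).
Local Notation mu2 := (mu \x mu)%E.
Local Notation U := (@unit_itv R).
Local Notation sq := (@unit_sq R).

(** The integrand built from u is an expectation: put y and z into A independently with
    probabilities u(y) and u(z); the resulting bipartite value is 0 or 1, and its expected distance
    to f(y, z) is exactly that expression. Rounding u at 1/2 costs a factor at most 4. Stability is
    proved in L1, because L1 closeness to a 0/1-valued function controls both the cut distance and
    the entropy.

    The objective is evaluated at an arbitrary representative, so a competitor is known only up to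
    cut distance 0. Its edge density survives exactly; one-sided bounds supply the rest: entropy >=
    0 for both competitors, t <= 1 for the constant, and t <= 6 times the cut distance for the
    bipartite one.

    Relabelings are bijections of [0, 1] at every point, so the rearrangement of A is assembled from
    explicit interval swaps.

    At a = -2 the terms of order N cancel at both candidates, and excluding the densities between
    them takes a quantitative gap: with w = 2 e - 1, t^gamma >= w + w (1 - w) / 6, where 1/6 = 1 -
    (3/2)(5/9). *)

Definition bounded_mfun d (T : measurableType d) (h : T -> R) :=
  measurable_fun setT h /\ exists M, forall x, `|h x| <= M.

Definition intU (h : RT -> R) : R := \int[mu]_(x in U) h x.
Local Notation J := intU.

Section BoundedMfun.
Context d (T : measurableType d).
Implicit Types h k : T -> R.

Lemma bounded_mfun_cst (c : R) : @bounded_mfun d T (fun=> c).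
Proof. by split; [exact: measurable_cst|exists `|c|]. Qed.

Lemma bounded_mfunD h k : bounded_mfun h -> bounded_mfun k ->
  bounded_mfun (fun x => h x + k x).
Proof.
move=> [mh [M hM]] [mk [N kN]]; split; first exact: measurable_funD.
by exists (M + N) => x; apply: le_trans (ler_normD _ _) _; exact: lerD.
Qed.

Lemma bounded_mfunN h : bounded_mfun h -> bounded_mfun (fun x => - h x).
Proof.
move=> [mh [M hM]]; split; first exact: measurableT_comp.
by exists M => x; rewrite normrN.
Qed.

Lemma bounded_mfunB h k : bounded_mfun h -> bounded_mfun k ->
  bounded_mfun (fun x => h x - k x).
Proof. by move=> bh bk; apply: bounded_mfunD => //; exact: bounded_mfunN. Qed.

Lemma bounded_mfunM h k : bounded_mfun h -> bounded_mfun k ->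
  bounded_mfun (fun x => h x * k x).
Proof.
move=> [mh [M hM]] [mk [N kN]]; split; first exact: measurable_funM.
by exists (M * N) => x; rewrite normrM; exact: ler_pM.
Qed.

Lemma bounded_mfun_norm h : bounded_mfun h -> bounded_mfun (fun x => `|h x|).
Proof.
move=> [mh [M hM]]; split; first exact: measurableT_comp.
by exists M => x; rewrite normr_id.
Qed.

Lemma bounded_mfun_comp d' (T' : measurableType d') (s : T' -> T) h :
  measurable_fun setT s -> bounded_mfun h -> bounded_mfun (fun x => h (s x)).
Proof.
move=> ms [mh [M hM]]; split; first exact: measurableT_comp.
by exists M => x.
Qed.

Lemma bounded_mfun_indic (A : set T) : measurable A -> bounded_mfun (\1_A : T -> R).
Proof.
move=> mA; split; first exact: measurable_indic.
by exists 1 => x; rewrite indicE; case: (_ \in _); rewrite ?normr1 ?normr0.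
Qed.

End BoundedMfun.

Lemma bounded_mfun_integrable (h : RT -> R) : bounded_mfun h ->
  mu.-integrable U (EFin \o h).
Proof.
move=> [mh [M hM]]; apply: measurable_bounded_integrable => //.
- exact: mU.
- by have /= := ltry (1 : R); rewrite -(@muU R).
- exact: measurable_funTS.
- exists M; split; first exact: num_real.
  by move=> N MN x _; apply: le_trans (hM x) (ltW MN).
Qed.

Lemma intU_cst c : J (fun=> c) = c.
Proof. rewrite /intU Rintegral_cst; last exact: mU.
by rewrite (_ : fine _ = 1) ?mulr1// [X in fine X](@muU R). Qed.

Lemma intUD (h k : RT -> R) : bounded_mfun h -> bounded_mfun k ->
  J (fun x => h x + k x) = J h + J k.
Proof. by move=> bh bk; rewrite /intU RintegralD//;
  [exact: mU|exact: bounded_mfun_integrable..]. Qed.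

Lemma intUB (h k : RT -> R) : bounded_mfun h -> bounded_mfun k ->
  J (fun x => h x - k x) = J h - J k.
Proof. by move=> bh bk; rewrite /intU RintegralB//;
  [exact: mU|exact: bounded_mfun_integrable..]. Qed.

Lemma intUZ c (h : RT -> R) : bounded_mfun h -> J (fun x => c * h x) = c * J h.
Proof. by move=> bh; rewrite /intU RintegralZl//;
  [exact: mU|exact: bounded_mfun_integrable]. Qed.

Lemma intUZr c (h : RT -> R) : bounded_mfun h -> J (fun x => h x * c) = J h * c.
Proof. by move=> bh; rewrite /intU RintegralZr//;
  [exact: mU|exact: bounded_mfun_integrable]. Qed.

Lemma le_intU (h k : RT -> R) : bounded_mfun h -> bounded_mfun k ->
  (forall x, U x -> h x <= k x) -> J h <= J k.
Proof.
by move=> bh bk hk; apply: le_Rintegral => //;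
  [exact: mU|exact: bounded_mfun_integrable..].
Qed.

Lemma intU_ge0 (h : RT -> R) : (forall x, U x -> 0 <= h x) -> 0 <= J h.
Proof. exact: Rintegral_ge0. Qed.

Lemma eq_intU (h k : RT -> R) : (forall x, U x -> h x = k x) -> J h = J k.
Proof. by move=> hk; apply: eq_Rintegral => x; rewrite inE; exact: hk. Qed.

Lemma norm_intU_le (h : RT -> R) M : bounded_mfun h ->
  (forall x, U x -> `|h x| <= M) -> `|J h| <= M.
Proof.
move=> bh hM; rewrite -[M]intU_cst; apply: le_trans.
  by apply: le_normr_Rintegral; [exact: mU|exact: bounded_mfun_integrable].
by apply: le_intU => //; [exact: bounded_mfun_norm|exact: bounded_mfun_cst].
Qed.

Lemma norm_intUB_le (h k : RT -> R) : bounded_mfun h -> bounded_mfun k ->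
  `|J h - J k| <= J (fun x => `|h x - k x|).
Proof.
move=> bh bk; rewrite -intUB//.
by apply: le_normr_Rintegral; [exact: mU|apply: bounded_mfun_integrable;
  exact: bounded_mfunB].
Qed.

(** Discards the point 1, which lies in no half-open cell; the cell rearrangements below are
    controlled only on [0, 1). *)
Lemma eq_intU_lt1 (h k : RT -> R) : bounded_mfun h -> bounded_mfun k ->
  (forall x : R, 0 <= x < 1 -> h x = k x) -> J h = J k.
Proof.
have J1 (g : RT -> R) : bounded_mfun g -> J g = \int[mu]_(x in `[0, 1[) g x.
  move=> bg; rewrite /intU /unit_itv -Rintegral_itv_bndo_bndc//.
  apply: integrableS (bounded_mfun_integrable bg); [exact: mU|exact: measurable_itv|].
  by move=> x; rewrite /unit_itv /= !in_itv /= => /andP[-> /ltW].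
move=> bh bk hk; rewrite !J1//; apply: eq_Rintegral => x.
by rewrite inE /= in_itv; exact: hk.
Qed.

(** The variance of [h], expanded, is nonnegative. *)
Lemma intU_sqr_ge (h : RT -> R) : bounded_mfun h ->
  J h ^+ 2 <= J (fun x => h x * h x).
Proof.
move=> bh.
have : 0 <= J (fun x => (h x - J h) * (h x - J h)).
  by apply: intU_ge0 => x _; exact: sqr_ge0.
rewrite (@eq_intU _ (fun x => h x * h x - (2 * J h * h x - J h * J h))); last first.
  by move=> x _; ring.
rewrite intUB ?intUB ?intUZ ?intU_cst//; first by nra.
- exact: bounded_mfun_cst.
- by apply: bounded_mfunM => //; exact: bounded_mfun_cst.
- exact: bounded_mfun_cst.
- exact: bounded_mfunM.
- by apply: bounded_mfunB; [apply: bounded_mfunM => //;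
  exact: bounded_mfun_cst|exact: bounded_mfun_cst].
Qed.

Lemma bounded_mfun_section d (T : measurableType d) (h : T * RT -> R) x :
  bounded_mfun h -> bounded_mfun (fun y => h (x, y)).
Proof. by apply: bounded_mfun_comp; apply: measurable_fun_pair. Qed.

Lemma bounded_mfun_sectionr d (T : measurableType d) (h : RT * T -> R) y :
  bounded_mfun h -> bounded_mfun (fun x => h (x, y)).
Proof. by apply: bounded_mfun_comp; apply: measurable_fun_pair. Qed.

Lemma bounded_mfun_intU d (T : measurableType d) (h : T * RT -> R) : bounded_mfun h ->
  bounded_mfun (fun x => J (fun y => h (x, y))).
Proof.
move=> bh; have [mh [M hM]] := bh; split; last first.
  by exists M => x; apply: norm_intU_le => //; exact: bounded_mfun_section.
(* Measurability comes from Tonelli, which wants a nonnegative integrand on the whole line: the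
   bound [M] supplies the sign, the indicator the domain, and [M] is subtracted afterwards. *)
pose k z := (h z + M) * \1_U z.2.
have bk : bounded_mfun k.
  apply: bounded_mfunM; first by apply: bounded_mfunD => //; exact: bounded_mfun_cst.
  by apply: (@bounded_mfun_comp _ _ _ _ snd) => //; apply: bounded_mfun_indic;
    exact: mU.
have k0 z : 0 <= k z.
  by rewrite mulr_ge0// -lerBlDr sub0r; have := hM z; rewrite ler_norml => /andP[].
have -> : (fun x => J (fun y => h (x, y))) =
    (fun x => fine (fubini_F mu (EFin \o k) x) - M).
  apply/funext => x; rewrite -[in RHS](intU_cst M) -[X in X - _]/(Rintegral _ _ _).
  have -> : \int[mu]_y (k (x, y)) = J (fun y => h (x, y) + M).
    rewrite /intU [RHS]Rintegral_mkcond; congr fine; apply: eq_integral => y _.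
    congr EFin; rewrite patchE /k indicE /=.
    by case: (_ \in _); rewrite ?mulr1 ?mulr0.
  rewrite -intUB; last 2 first.
    by apply: bounded_mfunD; [exact: bounded_mfun_section|exact: bounded_mfun_cst].
    exact: bounded_mfun_cst.
  by apply: eq_intU => y _; rewrite addrK.
apply: measurable_funB => //; apply: measurableT_comp => //.
apply: measurable_fun_fubini_tonelli_F; last by move=> z; rewrite lee_fin k0.
by apply/measurable_EFinP; case: bk.
Qed.

Lemma bounded_mfun_bmfun (h : RT * RT -> R) : bounded_mfun h -> bmfun h.
Proof.
by move=> [mh [M hM]]; split; [exact: measurable_funTS|exists M => *].
Qed.

Let patch_integrable (h : RT * RT -> R) : bounded_mfun h ->
  (mu \x mu)%E.-integrable setT (EFin \o (h \_ sq)).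
Proof.
move=> bh; rewrite -restrict_EFin; apply/(integrable_mkcond _ (@munit_sq R)).
by apply: bmfun_integrable => //; [exact: bounded_mfun_bmfun|exact: mU..].
Qed.

Let patch_sqE (h : RT * RT -> R) x y :
  (h \_ sq) (x, y) = \1_U x * \1_U y * h (x, y).
Proof. by rewrite patchE !indicE in_setX /=; do 2!case: (_ \in _);
  rewrite ?mul1r ?mul0r. Qed.

Let intU_indic (h : RT -> R) : bounded_mfun h ->
  (\int[mu]_x (\1_U x * h x)%:E)%E = (J h)%:E.
Proof.
move=> bh; rewrite /intU /Rintegral fineK; last first.
  by apply: integrable_fin_num; [exact: mU|exact: bounded_mfun_integrable].
rewrite [RHS]integral_mkcond; apply: eq_integral => x _.
by rewrite patchE indicE; case: (_ \in _); rewrite ?mul1r ?mul0r.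
Qed.

Lemma Rintegral_intU (h : RT * RT -> R) : bounded_mfun h ->
  \int[mu2]_(z in sq) h z = J (fun x => J (fun y => h (x, y))).
Proof.
move=> bh; rewrite Rintegral_mkcond /Rintegral.
rewrite -(integral12_prod_meas1 (patch_integrable bh)).
transitivity (fine (\int[mu]_x (\1_U x * J (fun y => h (x, y)))%:E)).
  congr fine; apply: eq_integral => x _; rewrite /fubini_F /=.
  rewrite -intUZ; last exact: bounded_mfun_section.
  rewrite -intU_indic; last by apply: bounded_mfunM;
    [exact: bounded_mfun_cst|exact: bounded_mfun_section].
  by apply: eq_integral => y _; rewrite patch_sqE mulrCA mulrA.
by rewrite intU_indic//; exact: bounded_mfun_intU.
Qed.

Lemma intU_swap (h : RT * RT -> R) : bounded_mfun h ->
  J (fun x => J (fun y => h (x, y))) = J (fun y => J (fun x => h (x, y))).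
Proof.
move=> bh; rewrite -Rintegral_intU// Rintegral_mkcond /Rintegral.
rewrite -(integral21_prod_meas1 (patch_integrable bh)).
have bh' : bounded_mfun (fun z : RT * RT => h (z.2, z.1)).
  by apply: bounded_mfun_comp bh; exact: measurable_fun_pair.
transitivity (fine (\int[mu]_y (\1_U y * J (fun x => h (x, y)))%:E)).
  congr fine; apply: eq_integral => y _; rewrite /fubini_G /=.
  rewrite -intUZ; last exact: bounded_mfun_sectionr.
  rewrite -intU_indic; last by apply: bounded_mfunM;
    [exact: bounded_mfun_cst|exact: bounded_mfun_sectionr].
  by apply: eq_integral => x _; rewrite patch_sqE mulrA.
by rewrite intU_indic//; exact: (bounded_mfun_intU bh').
Qed.

End UnitIntegral.

Opaque intU.

(** * Kernels on the unit square *)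

Ltac solve_bm :=
  repeat first
  [ assumption
  | exact: bounded_mfun_cst
  | match goal with
    | |- bounded_mfun (fun x => @?a x + - @?b x) =>
        refine (@bounded_mfunB _ _ _ a b _ _)
    | |- bounded_mfun (fun x => @?a x + @?b x) => refine (@bounded_mfunD _ _ _ a b _ _)
    | |- bounded_mfun (fun x => - @?a x) => refine (@bounded_mfunN _ _ _ a _)
    | |- bounded_mfun (fun x => @?a x * @?b x) => refine (@bounded_mfunM _ _ _ a b _ _)
    | |- bounded_mfun (fun x => `|@?a x|) => refine (@bounded_mfun_norm _ _ _ a _)
    | |- bounded_mfun (fun x => ?F (@?a x, @?b x)) =>
        refine (@bounded_mfun_comp _ _ _ _ _ (fun x => (a x, b x)) F _ _);
          [by apply: measurable_fun_pair => //; apply: measurableT_comp|]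
    | |- bounded_mfun (fun x => \1_?A (@?a x)) =>
        refine (@bounded_mfun_comp _ _ _ _ _ a (\1_A) _ _);
          [by [|apply: measurableT_comp]|apply: bounded_mfun_indic]
    end ].

Section Kernels.
Context (R : realType).
Local Notation RT := (measurableTypeR R).
Local Notation U := (@unit_itv R).
Local Notation J := (@intU R).

Definition intU2 (h : RT * RT -> R) := J (fun x => J (fun y => h (x, y))).
Local Notation J2 := intU2.
Definition intU3 (h : RT * RT * RT -> R) := J2 (fun p => J (fun z => h (p, z))).
Local Notation J3 := intU3.

Lemma intU2_cst c : J2 (fun=> c) = c.
Proof. by rewrite /intU2 !intU_cst. Qed.

Lemma intU2D h k : bounded_mfun h -> bounded_mfun k ->
  J2 (fun p => h p + k p) = J2 h + J2 k.
Proof.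
move=> bh bk; rewrite /intU2 -intUD; [|exact: bounded_mfun_intU..].
by congr J; apply/funext => x; rewrite intUD//; exact: bounded_mfun_section.
Qed.

Lemma intU2Z c h : bounded_mfun h -> J2 (fun p => c * h p) = c * J2 h.
Proof.
move=> bh; rewrite /intU2 -intUZ; last exact: bounded_mfun_intU.
by congr J; apply/funext => x; rewrite intUZ//; exact: bounded_mfun_section.
Qed.

Lemma intU2B h k : bounded_mfun h -> bounded_mfun k ->
  J2 (fun p => h p - k p) = J2 h - J2 k.
Proof.
move=> bh bk; rewrite /intU2 -intUB; [|exact: bounded_mfun_intU..].
by congr J; apply/funext => x; rewrite intUB//; exact: bounded_mfun_section.
Qed.

Lemma le_intU2 h k : bounded_mfun h -> bounded_mfun k ->
  (forall x y, U x -> U y -> h (x, y) <= k (x, y)) -> J2 h <= J2 k.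
Proof.
move=> bh bk hk; apply: le_intU; [exact: bounded_mfun_intU..|move=> x Ux].
by apply: le_intU => [||y Uy]; [exact: bounded_mfun_section..|exact: hk].
Qed.

Lemma intU2_ge0 h : (forall x y, U x -> U y -> 0 <= h (x, y)) -> 0 <= J2 h.
Proof. by move=> h0; apply: intU_ge0 => x Ux; apply: intU_ge0 => y Uy; exact: h0. Qed.

Lemma eq_intU2 h k : (forall x y, U x -> U y -> h (x, y) = k (x, y)) ->
  J2 h = J2 k.
Proof. by move=> hk; apply: eq_intU => x Ux; apply: eq_intU => y Uy; exact: hk. Qed.

Lemma intU3_cst c : J3 (fun=> c) = c.
Proof. by rewrite /intU3 /intU2 !intU_cst. Qed.

Lemma intU3D h k : bounded_mfun h -> bounded_mfun k ->
  J3 (fun p => h p + k p) = J3 h + J3 k.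
Proof.
move=> bh bk; rewrite /intU3 -intU2D; [|exact: bounded_mfun_intU..].
by congr J2; apply/funext => x; rewrite intUD//; exact: bounded_mfun_section.
Qed.

Lemma intU3Z c h : bounded_mfun h -> J3 (fun p => c * h p) = c * J3 h.
Proof.
move=> bh; rewrite /intU3 -intU2Z; last exact: bounded_mfun_intU.
by congr J2; apply/funext => x; rewrite intUZ//; exact: bounded_mfun_section.
Qed.

Lemma intU3B h k : bounded_mfun h -> bounded_mfun k ->
  J3 (fun p => h p - k p) = J3 h - J3 k.
Proof.
move=> bh bk; rewrite /intU3 -intU2B; [|exact: bounded_mfun_intU..].
by congr J2; apply/funext => x; rewrite intUB//; exact: bounded_mfun_section.
Qed.

Lemma le_intU3 h k : bounded_mfun h -> bounded_mfun k ->
  (forall x y z, U x -> U y -> U z -> h (x, y, z) <= k (x, y, z)) ->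
  J3 h <= J3 k.
Proof.
move=> bh bk hk; apply: le_intU2; [exact: bounded_mfun_intU..|move=> x y Ux Uy].
by apply: le_intU => [||z Uz]; [exact: bounded_mfun_section..|exact: hk].
Qed.

Definition kernel01 (F : RT * RT -> R) := [/\ bounded_mfun F,
  forall x y, F (x, y) = F (y, x) & forall p, 0 <= F p <= 1].

Definition edge_density (F : RT * RT -> R) := J2 F.

Definition triangle_density (F : RT * RT -> R) :=
  J3 (fun p => F (p.1.1, p.1.2) * F (p.1.1, p.2) * F (p.1.2, p.2)).

Definition bip (A : set RT) (p : RT * RT) : R :=
  \1_A p.1 + \1_A p.2 - 2 * (\1_A p.1 * \1_A p.2).

Lemma bounded_mfun_bip A : measurable A -> bounded_mfun (bip A).
Proof. by move=> mA; rewrite /bip; solve_bm. Qed.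

Lemma bip_values A p : bip A p = 0 \/ bip A p = 1.
Proof.
rewrite /bip !indicE; case: (_ \in _); case: (_ \in _) => /=;
  by [left; ring|right; ring].
Qed.

Section OneKernel.
Variable F : RT * RT -> R.
Hypothesis kF : kernel01 F.

Let bF : bounded_mfun F. Proof. by case: kF. Qed.
Let symF x y : F (x, y) = F (y, x). Proof. by case: kF. Qed.
Let F01 p : 0 <= F p <= 1. Proof. by case: kF. Qed.

Let deg x := J (fun y => F (x, y)).
(** Density of the path with two edges. By symmetry of [F], any of the three variables may be its
    middle vertex, whence [cherry_x], [cherry_y] and [cherry_z]. *)
Let D := J (fun x => deg x * deg x).
Local Notation e := (edge_density F).
Local Notation t := (triangle_density F).

Let bdeg : bounded_mfun deg. Proof. exact: bounded_mfun_intU. Qed.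

Let bFxy : bounded_mfun (fun p : RT * RT * RT => F (p.1.1, p.1.2)).
Proof. by solve_bm. Qed.
Let bFxz : bounded_mfun (fun p : RT * RT * RT => F (p.1.1, p.2)).
Proof. by solve_bm. Qed.
Let bFyz : bounded_mfun (fun p : RT * RT * RT => F (p.1.2, p.2)).
Proof. by solve_bm. Qed.

Lemma intU3_xy : J3 (fun p => F (p.1.1, p.1.2)) = e.
Proof. by rewrite /intU3; congr J2; apply/funext => -[x y]; rewrite /= intU_cst. Qed.

Lemma intU3_xz : J3 (fun p => F (p.1.1, p.2)) = e.
Proof. rewrite /intU3 /intU2; congr J; apply/funext => x. by rewrite /= intU_cst. Qed.

Lemma intU3_yz : J3 (fun p => F (p.1.2, p.2)) = e.
Proof. by rewrite /intU3 /intU2 /= intU_cst. Qed.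

Lemma cherry_x : J3 (fun p => F (p.1.1, p.1.2) * F (p.1.1, p.2)) = D.
Proof.
rewrite /intU3 /intU2; congr J; apply/funext => x.
rewrite /= -intUZr; last exact: bounded_mfun_section.
by congr J; apply/funext => y; rewrite /= intUZ//; exact: bounded_mfun_section.
Qed.

Lemma deg_xy : J (fun x => J (fun y => F (x, y) * deg y)) = D.
Proof.
rewrite (@intU_swap _ (fun p => F p * deg p.2)); last first.
  by apply: bounded_mfunM => //; apply: (@bounded_mfun_comp _ _ _ _ _ snd).
congr J; apply/funext => y; rewrite /= intUZr; last exact: bounded_mfun_sectionr.
by congr (_ * _); congr J; apply/funext => x.
Qed.

Lemma cherry_y : J3 (fun p => F (p.1.1, p.1.2) * F (p.1.2, p.2)) = D.
Proof.
rewrite -deg_xy /intU3 /intU2; congr J; apply/funext => x; congr J; apply/funext => y.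
by rewrite /= intUZ//; exact: bounded_mfun_section.
Qed.

Lemma cherry_z : J3 (fun p => F (p.1.1, p.2) * F (p.1.2, p.2)) = D.
Proof.
rewrite -deg_xy /intU3 /intU2; congr J; apply/funext => x.
rewrite (@intU_swap _ (fun p => F (x, p.2) * F p)); last by solve_bm.
congr J; apply/funext => z; rewrite /= intUZ//; last exact: bounded_mfun_sectionr.
by congr (_ * _); congr J; apply/funext => y.
Qed.

Lemma edge_density_itv : 0 <= e <= 1.
Proof.
apply/andP; split; first by apply: intU2_ge0 => x y _ _; case/andP: (F01 (x, y)).
rewrite -[leRHS]intU2_cst; apply: le_intU2 => //; first exact: bounded_mfun_cst.
by move=> x y _ _; case/andP: (F01 (x, y)).
Qed.

Lemma triangle_density_itv : 0 <= t <= 1.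
Proof.
apply/andP; split.
  apply: intU2_ge0 => x y _ _; apply: intU_ge0 => z _ /=.
  have := F01 (x, y); have := F01 (x, z); have := F01 (y, z).
  by move=> /andP[? _] /andP[? _] /andP[? _]; rewrite !mulr_ge0.
rewrite -[leRHS]intU3_cst; apply: le_intU3; [by solve_bm|exact: bounded_mfun_cst|].
move=> x y z _ _ _ /=.
have := F01 (x, y); have := F01 (x, z); have := F01 (y, z).
by move=> /andP[? ?] /andP[? ?] /andP[? ?]; rewrite mulr_ile1// ?mulr_ge0 ?mulr_ile1.
Qed.

Lemma cherry_ge : e ^+ 2 <= D.
Proof. exact: intU_sqr_ge. Qed.

(** Integrating u (1 - v) (1 - w) >= 0 over the three edge values of a triple gives
    [D + D - e <= t]; then [cherry_ge] bounds [D] below by the square of [e]. *)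
Lemma goodman : e * (2 * e - 1) <= t.
Proof.
have De := cherry_ge.
suff : D + D - e <= t by nra.
rewrite -{1}cherry_x -cherry_y -intU3_xy -intU3D; [|by solve_bm..].
rewrite -intU3B; [|by solve_bm..].
rewrite /triangle_density; apply: le_intU3; [by solve_bm..|].
move=> x y z _ _ _ /=.
have := F01 (x, y); have := F01 (x, z); have := F01 (y, z).
move: (F (x, y)) (F (x, z)) (F (y, z)) => u v w.
move=> /andP[? ?] /andP[? ?] /andP[? ?].
rewrite -subr_ge0 (_ : _ - _ = u * ((1 - v) * (1 - w))); last by ring.
by rewrite !mulr_ge0// subr_ge0.
Qed.

(** The expected L1 error of the random bipartition drawn from row [x], expanded into monomials so
    that its average over [x] is a combination of triangle, cherry and edge densities. *)
Let S x := J2 (fun p => 4 * (F (x, p.1) * F (x, p.2) * F p)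
   - 2 * (F (x, p.1) * F p) - 2 * (F (x, p.2) * F p) + F p
   + F (x, p.1) + F (x, p.2) - 2 * (F (x, p.1) * F (x, p.2))).

Lemma intU_imbalance : J S = 4 * t + 3 * e - 6 * D.
Proof.
transitivity (J3 (fun p =>
   4 * (F (p.1.1, p.1.2) * F (p.1.1, p.2) * F (p.1.2, p.2))
   - 2 * (F (p.1.1, p.1.2) * F (p.1.2, p.2))
   - 2 * (F (p.1.1, p.2) * F (p.1.2, p.2)) + F (p.1.2, p.2)
   + F (p.1.1, p.1.2) + F (p.1.1, p.2)
   - 2 * (F (p.1.1, p.1.2) * F (p.1.1, p.2)))); first by [].
rewrite intU3B; [|by solve_bm..].
do 3! (rewrite intU3D; [|by solve_bm..]).
do 2! (rewrite intU3B; [|by solve_bm..]).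
do 4! (rewrite intU3Z; [|by solve_bm]).
rewrite intU3_xy intU3_xz intU3_yz cherry_x cherry_y cherry_z -/t.
by ring.
Qed.

Let bS : bounded_mfun S.
Proof.
rewrite /S /intU2.
apply: (@bounded_mfun_intU _ _ _ (fun q : RT * RT => J (fun z =>
  4 * (F q * F (q.1, z) * F (q.2, z))
   - 2 * (F q * F (q.2, z)) - 2 * (F (q.1, z) * F (q.2, z)) + F (q.2, z)
   + F q + F (q.1, z) - 2 * (F q * F (q.1, z))))).
apply: (@bounded_mfun_intU _ _ _ (fun p : RT * RT * RT =>
   4 * (F p.1 * F (p.1.1, p.2) * F (p.1.2, p.2))
   - 2 * (F p.1 * F (p.1.2, p.2))
   - 2 * (F (p.1.1, p.2) * F (p.1.2, p.2)) + F (p.1.2, p.2)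
   + F p.1 + F (p.1.1, p.2)
   - 2 * (F p.1 * F (p.1.1, p.2)))).
have bF1 : bounded_mfun (fun p : RT * RT * RT => F p.1)
  by exact: (@bounded_mfun_comp _ _ _ _ _ fst).
by solve_bm.
Qed.

(** Some row has [S x] at most its average up to slack; thresholding that row at 1/2 loses a factor
    4, so the bound is 4 times (4 t + 3 e (1 - 2 e)), plus [eps]. *)
Lemma bip_stability (eps : R) : 0 < eps -> exists2 A : set RT, measurable A &
  J2 (fun p => `|F p - bip A p|) <= 16 * t + 12 * e * (1 - 2 * e) + eps.
Proof.
move=> eps0.
(* Integrating a strict pointwise inequality yields only a weak one, so the slack [eps / 4] is what
   produces the contradiction. *)
have [x Sx] : exists x, S x <= 4 * t + 3 * e * (1 - 2 * e) + eps / 4.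
  apply: contrapT => /forallNP nS.
  have : J (fun=> 4 * t + 3 * e * (1 - 2 * e) + eps / 4) <= J S.
    apply: le_intU => //; first exact: bounded_mfun_cst.
    by move=> x _; rewrite ltW// ltNge; apply/negP/nS.
  by rewrite intU_cst intU_imbalance; have := cherry_ge; nra.
pose A := [set y | 1 / 2 <= F (x, y)].
have bFx : bounded_mfun (fun y => F (x, y)) by exact: bounded_mfun_section.
have mA : measurable A.
  rewrite (_ : A = (fun y => F (x, y)) @^-1` `[1/2, +oo[).
    by rewrite -[_ @^-1` _]setTI; case: bFx => m _; apply: m => //;
      exact: measurable_itv.
  by apply/seteqP; split=> y /=; rewrite in_itv /= andbT.
exists A => //.
apply: (@le_trans _ _ (4 * S x)); last by lra.
have bF1 : bounded_mfun (fun p : RT * RT => F (x, p.1)) by solve_bm.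
have bF2 : bounded_mfun (fun p : RT * RT => F (x, p.2)) by solve_bm.
have bA := bounded_mfun_bip mA.
rewrite /S -intU2Z; last by solve_bm.
apply: le_intU2; [by solve_bm..|move=> y z _ _ /=].
rewrite /bip !indicE /=.
have Ay : (y \in A) = (1/2 <= F (x, y)) by apply/idP/idP; rewrite inE.
have Az : (z \in A) = (1/2 <= F (x, z)) by apply/idP/idP; rewrite inE.
rewrite Ay Az.
have := F01 (x, y); have := F01 (x, z); have := F01 (y, z).
move: (F (x, y)) (F (x, z)) (F (y, z)) => u v w.
move=> /andP[w0 w1] /andP[v0 v1] /andP[u0 u1].
have H1 : 0 <= u * v * w by rewrite !mulr_ge0.
have H2 : 0 <= (1 - u) * (1 - v) * w by rewrite !mulr_ge0// subr_ge0.
have H3 : 0 <= u * (1 - v) * (1 - w) by rewrite !mulr_ge0// subr_ge0.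
have H4 : 0 <= (1 - u) * v * (1 - w) by rewrite !mulr_ge0// subr_ge0.
have -> : 4 * (4 * (u * v * w) - 2 * (u * w) - 2 * (v * w) + w + u + v - 2 * (u * v))
  = 4 * (u * v * w) + 4 * ((1 - u) * (1 - v) * w) + 4 * (u * (1 - v) * (1 - w)) +
    4 * ((1 - u) * v * (1 - w)) by ring.
have w1' : 0 <= 1 - w by rewrite subr_ge0.
(* In each case one of the four nonnegative summands carries two weights that are both at least 1/2,
   hence a factor at least 1/4, times the error at (y, z). *)
have [hu|hu] := leP (1/2) u; have [hv|hv] := leP (1/2) v => /=;
  rewrite ?(mulr0, mulr1, mul0r, mul1r, addr0, add0r, subr0).
- have : 0 <= (u - 1/2) * v by rewrite mulr_ge0// subr_ge0.
  have : 1/4 * w <= u * v * w by rewrite ler_wpM2r//; nra.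
  by rewrite (_ : w - _ = w) ?ger0_norm//; [lra|ring].
- have : 1/4 * (1 - w) <= u * (1 - v) * (1 - w) by rewrite ler_wpM2r//; nra.
  by rewrite ler0_norm; lra.
- have : 1/4 * (1 - w) <= (1 - u) * v * (1 - w) by rewrite ler_wpM2r//; nra.
  by rewrite ler0_norm; lra.
- have : 1/4 * w <= (1 - u) * (1 - v) * w by rewrite ler_wpM2r//; nra.
  by rewrite ger0_norm//; lra.
Qed.

End OneKernel.
End Kernels.

(** * Measure preserving rearrangements *)

Section Rearrangement.
Context (R : realType).
Local Notation RT := (measurableTypeR R).
Local Notation mu := (@lebesgue_measure R).
Local Notation mu2 := (mu \x mu)%E.
Local Notation U := (@unit_itv R).
Local Notation sq := (@unit_sq R).
Local Notation J := (@intU R).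

Definition translate (c : R) : RT -> RT := fun x : R => x + c.

Lemma measurable_translate c : measurable_fun setT (translate c).
Proof. by apply: measurable_funD. Qed.

Lemma mu_translate c (A : set RT) : measurable A ->
  mu (translate c @^-1` A) = mu A.
Proof.
move=> mA; have mt := measurable_translate c.
pose m' := measure_function_pushforward__canonical__measure_function_Measure mu mt.
suff /(_ A mA) -> : forall X : set RT, measurable X -> mu X = m' X by [].
apply: lebesgue_measure_unique => _ [[a b] _ <-].
rewrite /m' /= /pushforward.
rewrite (_ : _ @^-1` _ = `]a - c, b - c]%classic); last first.
  by apply/seteqP; split=> x /=; rewrite !in_itv/= /translate ltrBlDr lerBrDr.
by rewrite !lebesgue_measure_itv /= !lte_fin ltrD2r -!EFinB opprB addrA subrK.
Qed.

(** Swaps [E] with its translate E + c and fixes all other points. The preimage of [E] under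
    [translate (- c)], abbreviated [Ec] below, is E + c. *)
Definition exchange (E : set RT) (c : R) : RT -> RT := fun x =>
  if x \in E then translate c x
  else if translate (- c) x \in E then translate (- c) x else x.

Section Exchange.
Variables (E : set RT) (c : R).
Hypothesis mE : measurable E.
Hypothesis EU : E `<=` U.
Hypothesis EcU : translate (- c) @^-1` E `<=` U.
Hypothesis EcE : E `&` translate (- c) @^-1` E = set0.
Local Notation s := (exchange E c).
Local Notation Ec := (translate (- c) @^-1` E).

Let trK x : translate (- c) (translate c x) = x.
Proof. exact: addrK. Qed.

Let trVK x : translate c (translate (- c) x) = x.
Proof. exact: subrK. Qed.

Lemma exchange_in x : E x -> s x = translate c x.
Proof. by move=> Ex; rewrite /exchange mem_set. Qed.

Lemma exchange_translated x : Ec x -> s x = translate (- c) x.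
Proof.
move=> Ecx; rewrite /exchange memNset; first by rewrite mem_set.
by move=> Ex; have : (E `&` Ec) x by []; rewrite EcE.
Qed.

Lemma exchange_out x : ~ E x -> ~ Ec x -> s x = x.
Proof. by move=> Ex Ecx; rewrite /exchange !memNset. Qed.

Lemma exchangeK : involutive s.
Proof.
move=> x; have [Ex|Ex] := pselect (E x).
  by rewrite (exchange_in Ex) exchange_translated ?trK//= trK.
have [Ecx|Ecx] := pselect (Ec x).
  by rewrite (exchange_translated Ecx) exchange_in ?trVK.
by rewrite !exchange_out.
Qed.

Lemma exchangeU x : U x -> U (s x).
Proof.
move=> Ux; have [Ex|Ex] := pselect (E x).
  by rewrite (exchange_in Ex); apply: EcU; rewrite /= trK.
have [Ecx|Ecx] := pselect (Ec x); last by rewrite exchange_out.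
by rewrite (exchange_translated Ecx); exact: EU.
Qed.

(** Since [s] is an involution, bijectivity is immediate and images are preimages. A preimage splits
    into three disjoint pieces, two translated and one fixed, so its measure follows from
    translation invariance. *)
Lemma mp_bij_exchange : mp_bij s.
Proof.
have mt := measurable_translate c; have mtV := measurable_translate (- c).
have mEc : measurable Ec by rewrite -[X in measurable X]setTI; exact: mtV.
have preE A : A `<=` U -> U `&` s @^-1` A =
    (E `&` translate c @^-1` (A `&` Ec)) `|` (Ec `&` translate (- c) @^-1` (A `&` E))
    `|` (A `\` (E `|` Ec)).
  move=> AU; apply/seteqP; split=> x /=.
    move=> [Ux As]; have [Ex|Ex] := pselect (E x).
      by left; left; rewrite (exchange_in Ex) in As; rewrite trK.
    have [Ecx|Ecx] := pselect (Ec x).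
      by left; right; rewrite (exchange_translated Ecx) in As.
    by right; rewrite exchange_out// in As; split=> // -[].
  move=> [[[Ex [Ax Ecx]]|[Ecx [Ax Ex]]]|[Ax nE]].
  - by rewrite (exchange_in Ex); split=> //; exact: EU.
  - by rewrite (exchange_translated Ecx); split=> //; exact: EcU.
  - rewrite exchange_out//; first by split=> //; exact: AU.
    by move=> ?; apply: nE; left.
    by move=> ?; apply: nE; right.
have m1 A : measurable A -> measurable (E `&` translate c @^-1` (A `&` Ec)).
  move=> mA; apply: measurableI => //; rewrite -[X in measurable X]setTI.
  by apply: mt => //; exact: measurableI.
have m2 A : measurable A -> measurable (Ec `&` translate (- c) @^-1` (A `&` E)).
  move=> mA; apply: measurableI => //; rewrite -[X in measurable X]setTI.
  by apply: mtV => //; exact: measurableI.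
have m3 A : measurable A -> measurable (A `\` (E `|` Ec)).
  by move=> mA; apply: measurableD => //; exact: measurableU.
have mpre A : measurable A -> A `<=` U -> measurable (U `&` s @^-1` A).
  move=> mA AU; rewrite preE//; apply: measurableU; last exact: m3.
  by apply: measurableU; [exact: m1|exact: m2].
split.
- split; first exact: exchangeU.
  + by move=> x y _ _ sxy; rewrite -[x]exchangeK sxy exchangeK.
  + by move=> x Ux; exists (s x); [exact: exchangeU|exact: exchangeK].
- move=> _ A mA; rewrite (_ : _ `&` _ = U `&` s @^-1` (A `&` U)).
    by apply: mpre => //; apply: measurableI => //; exact: mU.
  apply/seteqP; split=> x /= [Ux]; last by case.
  by move=> Ax; split=> //; split=> //; exact: exchangeU.
- move=> A mA AU; rewrite (_ : _ @` _ = U `&` s @^-1` A); first exact: mpre.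
  apply/seteqP; split=> x /=.
    by move=> [y Ay <-]; rewrite exchangeK; split=> //; apply/exchangeU/AU.
  by move=> [Ux Asx]; exists (s x) => //; exact: exchangeK.
- move=> A mA AU; rewrite preE//.
  have disj : (E `|` Ec) `&` (A `\` (E `|` Ec)) = set0.
    by apply/seteqP; split=> // x [? []].
  rewrite measureU//; last 3 first.
    by apply: measurableU; [exact: m1|exact: m2].
    exact: m3.
    by apply: subsetI_eq0 disj => //; apply: setUSS; exact: subIsetl.
  rewrite measureU//; last 3 first.
    exact: m1.
    exact: m2.
    by apply: subsetI_eq0 EcE; exact: subIsetl.
  have -> : E `&` translate c @^-1` (A `&` Ec) = translate c @^-1` (A `&` Ec).
    by apply/setIidPr => x /= [_]; rewrite trK.
  have -> : Ec `&` translate (- c) @^-1` (A `&` E) = translate (- c) @^-1` (A `&` E).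
    by apply/setIidPr => x /= [].
  have mAE : measurable (A `&` E) by exact: measurableI.
  have mAEc : measurable (A `&` Ec) by exact: measurableI.
  transitivity (mu (A `&` Ec) + mu (A `&` E) + mu (A `\` (E `|` Ec)))%E.
    by congr (_ + _ + _)%E; exact: mu_translate.
  rewrite -measureU//; last first.
    by rewrite setIACA (setIC Ec) EcE setI0.
  rewrite -measureU//; last 3 first.
    exact: measurableU.
    exact: m3.
    by apply: subsetI_eq0 disj => // x [] [_ ?]; [right|left].
  congr (mu _); rewrite -setIUr (setUC Ec); exact: setUIDK.
Qed.

End Exchange.

(** One-dimensional change of variables, read off [Rintegral_relabel] on the full square for a
    function of the first coordinate alone. *)
Lemma intU_mp_ext s (h : RT -> R) : mp_bij s -> bounded_mfun h ->
  J (fun x => h (mp_ext s x)) = J h.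
Proof.
move=> bs bh; have [[fs is_ ss] ms ims ps] := bs.
have mext := measurable_mp_ext bs.
have bh1 : bounded_mfun (fun p : RT * RT => h p.1)
  by exact: (@bounded_mfun_comp _ _ _ _ _ fst).
have bh2 : bounded_mfun (fun p : RT * RT => h (mp_ext s p.1)).
  by apply: (@bounded_mfun_comp _ _ _ _ _ (fun p => mp_ext s p.1)) => //;
    exact: measurableT_comp.
have sU : s @` U = U.
  apply/seteqP; split=> x /=; first by move=> [y Uy <-]; exact: fs.
  by move=> Ux; have [y Uy <-] := ss _ Ux; exists y.
have := Rintegral_relabel bs (bounded_mfun_bmfun bh1) (@mU R) (@mU R)
  (@subset_refl _ U) (@subset_refl _ U).
rewrite !sU (Rintegral_intU bh1) /=.
have -> : \int[mu2]_(z in U `*` U) relabel s (fun p => h p.1) z =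
    \int[mu2]_(z in sq) h (mp_ext s z.1).
  apply: eq_Rintegral => -[x y]; rewrite inE => -[/= Ux Uy].
  by rewrite mp_extE.
rewrite (Rintegral_intU bh2) /=.
under eq_fun do rewrite intU_cst.
by under [X in _ = J X -> _]eq_fun do rewrite intU_cst.
Qed.

(** * Permutations of cells of equal length *)

Section Cells.
Variable n : nat.
Local Notation m := n.+1.
Implicit Types (i j : 'I_m) (K : {set 'I_m}).

Definition cell i : set RT := [set x : R | i%:R / m%:R <= x < i.+1%:R / m%:R].

Definition cells K : set RT := [set x | exists2 i, i \in K & cell i x].

Lemma cell_uniq i j x : cell i x -> cell j x -> i = j.
Proof.
move=> /andP[ix xi] /andP[jx xj]; apply/val_inj/eqP => /=.
have m0 : 0 < (m%:R : R)^-1 by rewrite invr_gt0 ltr0n.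
rewrite eqn_leq; apply/andP; split; rewrite -ltnS -(ltr_nat R) -(ltr_pM2r m0).
  exact: le_lt_trans ix xj.
exact: le_lt_trans jx xi.
Qed.

Lemma cellU i : cell i `<=` U.
Proof.
move=> x /andP[ix xi]; rewrite /unit_itv /= in_itv /=; apply/andP; split.
  by apply: le_trans ix; rewrite divr_ge0.
by apply/ltW/(lt_le_trans xi); rewrite ler_pdivrMr ?ltr0n// mul1r ler_nat.
Qed.

Lemma measurable_cell i : measurable (cell i).
Proof.
rewrite (_ : cell i = [set` `[i%:R / m%:R, i.+1%:R / m%:R[%R]);
  first exact: measurable_itv.
by apply/seteqP; split=> x /=; rewrite in_itv.
Qed.

Lemma measurable_cells K : measurable (cells K).
Proof.
rewrite (_ : cells K = \bigcup_(i in [set i | i \in K]) cell i).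
  by apply: fin_bigcup_measurable => // i _; exact: measurable_cell.
by apply/seteqP; split=> x [i iK xi]; exists i.
Qed.

Lemma cell_ex (x : R) : 0 <= x < 1 -> exists i, cell i x.
Proof.
move=> /andP[x0 x1].
have m0 : 0 < m%:R :> R by rewrite ltr0n.
have /andP[k1 k2] := truncn_itv (mulr_ge0 x0 (ltW m0)).
have km : (Num.truncn (x * m%:R) < m)%N.
  by rewrite -(ltr_nat R); apply: le_lt_trans k1 _; rewrite gtr_pMl.
by exists (Ordinal km); rewrite /cell /= ler_pdivrMr// ltr_pdivlMr// k1 k2.
Qed.

(** All cells have the same length, so a transposition is an [exchange] by the difference of the
    left endpoints. *)
Lemma mp_bij_tperm i j : exists2 s : RT -> RT, mp_bij s &
  forall l x, U x -> cell l x -> cell (tperm i j l) (s x).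
Proof.
have [->|ij] := eqVneq i j.
  by exists id; [exact: mp_bij_id|move=> l x _; rewrite tperm1 perm1].
pose c : R := j%:R / m%:R - i%:R / m%:R.
have shiftE (k l : 'I_m) (d x : R) : d = l%:R / m%:R - k%:R / m%:R ->
    cell l (translate d x) <-> cell k x.
  move=> ->; rewrite /cell /translate /= -[l.+1]addn1 -[k.+1]addn1 !natrD !mulrDl.
  move: (l%:R / _) (k%:R / _) (1%:R / _) => u v w.
  by split=> /andP[h1 h2]; apply/andP; split; lra.
have EcE : translate (- c) @^-1` cell i = cell j.
  by apply/seteqP; split=> x /= /(@shiftE j i); apply; rewrite /c; ring.
have disj : cell i `&` cell j = set0.
  by apply/seteqP; split=> // x [xi xj]; move: ij; rewrite (cell_uniq xi xj) eqxx.
exists (exchange (cell i) c).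
  apply: mp_bij_exchange; rewrite ?EcE//; [exact: measurable_cell|exact: cellU..].
move=> l x Ux; case: tpermP => [->|->|li lj] xl.
- by rewrite exchange_in//; apply/(@shiftE i j).
- by rewrite exchange_translated ?EcE//; apply/(@shiftE j i) => //; rewrite /c; ring.
- rewrite exchange_out ?EcE// => xk; first by apply: li; exact: cell_uniq xl xk.
  by apply: lj; exact: cell_uniq xl xk.
Qed.

Lemma mp_bij_perm (p : {perm 'I_m}) : exists2 s : RT -> RT, mp_bij s &
  forall l x, U x -> cell l x -> cell (p l) (s x).
Proof.
have [ts -> _] := prod_tpermP p.
elim: ts => [|t ts [s bs sP]]; rewrite ?big_nil ?big_cons.
  by exists id; [exact: mp_bij_id|move=> l x _; rewrite perm1].
have [s' bs' s'P] := mp_bij_tperm t.1 t.2.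
(* Products of permutations act left to right, so the head transposition [t] is applied first. *)
exists (s \o s'); first exact: mp_bij_comp.
move=> l x Ux xl; rewrite permM; apply: sP; last exact: s'P.
exact: mp_bijU Ux.
Qed.

(** The permutation lists [K] first and its complement afterwards; the induced rearrangement makes
    the preimage of [cells K] an initial interval. *)
Lemma perm_initial_segment K : exists p : {perm 'I_m},
  forall i, (p i \in K) = (i < #|K|)%N.
Proof.
pose e := enum K ++ enum (~: K).
have se : size e = m by rewrite size_cat -!cardE cardsC card_ord.
have ue : uniq e.
  rewrite cat_uniq !enum_uniq andbT; apply/hasPn => i /=.
  by rewrite !mem_enum inE.
have inj : injective (fun i : 'I_m => nth ord0 e i).
  by move=> i j /eqP; rewrite nth_uniq ?se// => /eqP/val_inj.
exists (perm inj) => i; rewrite permE nth_cat -cardE; case: ltnP => h.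
  by rewrite -mem_enum mem_nth// -cardE.
apply/negbTE; rewrite -finset.in_setC -mem_enum mem_nth// -cardE ltn_subLR//.
by rewrite cardsC card_ord.
Qed.

Lemma mp_bij_cells K : exists2 s : RT -> RT, mp_bij s &
  forall x : R, 0 <= x < 1 -> cells K (s x) <-> x < #|K|%:R / m%:R.
Proof.
have [p pK] := perm_initial_segment K; have [s bs sP] := mp_bij_perm p.
exists s => // x x01; have [i xi] := cell_ex x01.
have m0 : 0 < (m%:R : R)^-1 by rewrite invr_gt0 ltr0n.
have sxi := sP _ _ (cellU xi) xi.
have -> : cells K (s x) <-> (i < #|K|)%N.
  rewrite -pK; split=> [[j jK sxj]|piK]; last by exists (p i).
  by rewrite (cell_uniq sxi sxj).
move: xi => /andP[ix xi]; split.
  move=> iK; apply: lt_le_trans xi _.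
  by rewrite ler_pM2r// ler_nat.
by move=> xK; have := le_lt_trans ix xK; rewrite ltr_pM2r// ltr_nat.
Qed.

End Cells.
End Rearrangement.
Arguments cell R {n}.
Arguments cells R {n}.

(** * Approximation of measurable sets by unions of cells *)

Section Approximation.
Context (R : realType).
Local Notation RT := (measurableTypeR R).
Local Notation mu := (@lebesgue_measure R).
Local Notation U := (@unit_itv R).
Local Notation J := (@intU R).

Transparent intU.

Lemma intU_indic (B : set RT) : measurable B -> J \1_B = fine (mu (B `&` U)).
Proof. by move=> mB; rewrite /intU /Rintegral integral_indic//; exact: mU. Qed.

Lemma intU_Rintegral (h : RT -> R) : J h = fine (\int[mu]_(x in U) (h x)%:E).
Proof. by []. Qed.

Opaque intU.

Lemma intU_indic_half : J \1_(`[0, 1 / 2[%classic : set RT) = 1 / 2.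
Proof.
rewrite intU_indic; last exact: measurable_itv.
rewrite (_ : _ `&` _ = `[0, 1/2[%classic); last first.
  apply/setIidPl => x; rewrite /unit_itv /= !in_itv /= => /andP[-> x2] /=.
  by apply/ltW/(lt_trans x2); lra.
by rewrite lebesgue_measure_itv /= lte_fin (_ : 0 < 1/2)//= ?subr0//; lra.
Qed.

Lemma bounded_mfun_indic_dist (A B : set RT) : measurable A -> measurable B ->
  bounded_mfun (fun x => `|\1_A x - \1_B x| : R).
Proof.
move=> mA mB; apply: (@bounded_mfun_norm _ _ _ (fun x => \1_A x - \1_B x)).
by apply: (@bounded_mfunB _ _ _ \1_A \1_B); exact: bounded_mfun_indic.
Qed.

Lemma indic01 (A : set RT) x : 0 <= (\1_A x : R) <= 1.
Proof. by rewrite indicE; case: (_ \in _); rewrite !lexx ler01. Qed.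

(** Take the cells contained in [V]. Each point of [V] in [0, 1) has a ball inside [V], which
    contains its cell once the mesh is below the radius; dominated convergence turns this pointwise
    statement into an L1 one. *)
Lemma cells_of_open (V : set R) (eps : R) : open V -> 0 < eps ->
  exists n (K : {set 'I_n.+1}),
  J (fun x => `|\1_(V `&` `[0, 1[ : set RT) x - \1_(cells R K) x|) <= eps.
Proof.
move=> oV eps0; pose V' : set RT := V `&` `[0, 1[.
have mV' : measurable V'.
  by apply: measurableI; [exact: open_measurable|exact: measurable_itv].
pose K n : {set 'I_n.+1} := [set i | `[< cell R i `<=` V >]]%SET.
have KV n : cells R (K n) `<=` V'.
  move=> x [i]; rewrite finset.in_set => /asboolP iV xi; split; first exact: iV.
  have := cellU xi; rewrite /unit_itv /= !in_itv /= => /andP[-> _] /=.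
  move: xi => /andP[_ xi]; apply: lt_le_trans xi _.
  by rewrite ler_pdivrMr ?ltr0n// mul1r ler_nat.
have VK x : V' x -> \forall n \near \oo, cells R (K n) x.
  move=> [Vx]; rewrite /= in_itv /= => x01.
  have /nbhs_ballP[d /= d0 dV] := open_nbhs_nbhs (conj oV Vx : open_nbhs x V).
  near=> n; have [i xi] := cell_ex n x01; exists i => //.
  rewrite finset.in_set; apply/asboolP => y yi; apply: dV.
  rewrite /ball /=.
  have nd : n.+1%:R^-1 < d by near: n; exact: near_infty_natSinv_lt (PosNum d0).
  move: xi yi => /andP[x1 x2] /andP[y1 y2].
  have iE : i.+1%:R / n.+1%:R = i%:R / n.+1%:R + n.+1%:R^-1 :> R.
    by rewrite -[i.+1]addn1 natrD mulrDl mul1r.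
  move: x1 x2 y1 y2 nd; rewrite iE;
    move: (i%:R / n.+1%:R : R) (n.+1%:R^-1 : R) => u w *.
  by rewrite ltr_norml; apply/andP; split; lra.
have := @dominated_convergence _ RT R mu U (@mU R)
  (fun n x => (\1_(cells R (K n)) x)%:E) (fun x => (\1_V' x)%:E) (cst 1%E).
case.
- move=> n; apply/measurable_EFinP; apply: measurable_indic.
  exact: measurable_cells.
- by apply/measurable_EFinP; apply: measurable_indic.
- apply: aeW => x _; apply: cvg_near_cst.
  have [Vx|nVx] := pselect (V' x).
    near=> n; rewrite !indicE !mem_set//; near: n; exact: VK.
  by apply: nearW => n; rewrite !indicE !memNset// => /KV.
- exact: (bounded_mfun_integrable (bounded_mfun_cst _ 1)).
- apply: aeW => x n _ /=; rewrite lee_fin.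
  by have /andP[? ?] := indic01 (cells R (K n)) x; rewrite ger0_norm.
move=> _ /fine_cvgP[_ /cvgrPdist_le /(_ _ eps0)] + _.
move=> [N _ /(_ N (leqnn N))] /=; rewrite sub0r normrN => Neps.
exists N, (K N); apply: le_trans Neps; apply: le_trans (ler_norm _).
rewrite intU_Rintegral le_eqVlt; apply/orP; left; apply/eqP; congr fine.
by apply: eq_integral => x _; rewrite distrC.
Unshelve. all: by end_near.
Qed.

(** Outer regularity replaces [A] by an open set at cost [eps / 2], and [cells_of_open] replaces
    that set by cells at the same cost. *)
Lemma intU_approx_cells (A : set RT) (eps : R) : measurable A -> 0 < eps ->
  exists n (K : {set 'I_n.+1}),
  J (fun x => `|\1_A x - \1_(cells R K) x|) <= eps.
Proof.
move=> mA eps0; have eps20 : 0 < eps / 2 by rewrite divr_gt0.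
pose A' : set R := A `&` `[0, 1[.
have mA' : measurable A' by apply: measurableI => //; exact: measurable_itv.
have A'fin : (mu A' < +oo)%E.
  apply: (@le_lt_trans _ _ (mu (`[0, 1[%classic : set R))).
    by apply: le_measure; rewrite ?inE//; exact: subIsetr.
  by rewrite lebesgue_measure_itv /= lte01 EFinN sube0 ltry.
have [V [oV A'V muV]] := lebesgue_regularity_outer mA' A'fin eps20.
have [n [K VK]] := cells_of_open oV eps20.
exists n, K.
have mV : measurable (V : set RT) by exact: open_measurable.
pose V' : set RT := V `&` `[0, 1[.
have mV' : measurable V' by apply: measurableI => //; exact: measurable_itv.
have mVA : measurable (V `\` A' : set RT) by exact: measurableD.
have m1 : measurable ([set 1] : set RT) by [].
have b1 := bounded_mfun_indic R m1; have bVA := bounded_mfun_indic R mVA.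
have bd : bounded_mfun (fun x : RT => `|\1_V' x - \1_(cells R K) x| : R).
  by apply: bounded_mfun_indic_dist => //; exact: measurable_cells.
(* The null singleton absorbs the point 1, which [A] may contain but which was removed from [A'] and
   [V']. *)
apply: (@le_trans _ _ (J (fun x => \1_([set 1] : set RT) x + \1_(V `\` A' : set RT) x +
    `|\1_V' x - \1_(cells R K) x|))).
  apply: le_intU.
  - by apply: bounded_mfun_indic_dist => //; exact: measurable_cells.
  - by apply: bounded_mfunD => //; exact: bounded_mfunD.
  move=> x Ux; move: (indic01 (cells R K) x); move: (\1_(cells R K) x) => u u01.
  have [->|x1] := eqVneq x 1.
    rewrite [\1_([set _]) _]indicE mem_set//=.
    apply: (@le_trans _ _ 1); last by rewrite -addrA lerDl addr_ge0//;
      case/andP: (indic01 (V `\` A') (1 : R)).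
    by have /andP[] := indic01 A 1; move: u01 => /andP[]; rewrite ler_norml; lra.
  have Hx : `[0, 1[%classic x.
    rewrite /= in_itv /=; move: Ux; rewrite /unit_itv /= in_itv /= => /andP[-> xl].
    by rewrite lt_neqAle x1.
  rewrite [\1_([set _]) _]indicE memNset ?add0r; last by move=> /= /eqP;
    rewrite (negbTE x1).
  apply: (@le_trans _ _ (`|\1_A x - \1_V' x| + `|\1_V' x - u|)).
    exact: ler_distD.
  rewrite lerD2r !indicE.
  have [Ax|Ax] := pselect (A x).
    rewrite (mem_set Ax) (mem_set (_ : V' x)) ?subrr ?normr0//.
    by split=> //; apply: A'V.
  rewrite (memNset Ax) sub0r normrN.
  have [Vx|Vx] := pselect (V x).
    by rewrite (mem_set (_ : (V `\` A') x)) ?ger0_norm// ?lef1//;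
      [case: (_ \in _)|split=> // -[]].
  by rewrite (memNset (_ : ~ V' x)) ?normr0//; case.
rewrite intUD//; last exact: bounded_mfunD.
rewrite intUD// [leRHS](splitr eps) lerD//.
rewrite !intU_indic//.
have -> : fine (mu ([set 1] `&` U)) = 0.
  rewrite (_ : mu _ = 0%E)//; apply/eqP;
    rewrite -measure_le0 -(lebesgue_measure_set1 (1 : R)).
  apply: le_measure; rewrite ?inE//.
  by apply: measurableI => //; exact: mU.
rewrite add0r -lee_fin fineK.
  apply: le_trans (ltW muV); apply: le_measure; rewrite ?inE//.
  by apply: measurableI => //; exact: mU.
rewrite ge0_fin_numE//; apply: le_lt_trans (ltry (eps / 2)).
apply: le_trans (ltW muV); apply: le_measure; rewrite ?inE//.
by apply: measurableI => //; exact: mU.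
Qed.

End Approximation.

(** * Rearranging a set towards [0, 1/2) *)

Section CutDistance.
Context (R : realType).
Local Notation RT := (measurableTypeR R).
Local Notation U := (@unit_itv R).
Local Notation J := (@intU R).
Local Notation H := (`[0, 1 / 2[%classic : set RT).

Lemma bounded_mfun_mp_ext s (h : RT -> R) : mp_bij s -> bounded_mfun h ->
  bounded_mfun (fun x => h (mp_ext s x)).
Proof. by move=> bs; apply: bounded_mfun_comp; exact: measurable_mp_ext. Qed.

(** Half of [eps] pays for replacing [A] by cells before the rearrangement, the other half for the
    resulting change in measure. After it, only two initial intervals are compared. *)
Lemma rearrange_half (A : set RT) (eps : R) : measurable A -> 0 < eps ->
  exists2 s, mp_bij s &
  J (fun x => `|\1_A (mp_ext s x) - \1_H x|) <= `|J \1_A - 1 / 2| + eps.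
Proof.
move=> mA eps0; have eps20 : 0 < eps / 2 by rewrite divr_gt0.
have [n [K AK]] := intU_approx_cells mA eps20.
have [s bs sK] := mp_bij_cells R K; exists s => //.
pose k : R := #|K|%:R / n.+1%:R; pose L : set RT := `[0, k[%classic.
have mH : measurable H by exact: measurable_itv.
have mL : measurable L by exact: measurable_itv.
have mK := @measurable_cells R _ K.
have bA : bounded_mfun (\1_A : RT -> R) by exact: bounded_mfun_indic.
have bK : bounded_mfun (\1_(cells R K) : RT -> R) by exact: bounded_mfun_indic.
have bL : bounded_mfun (\1_L : RT -> R) by exact: bounded_mfun_indic.
have bH : bounded_mfun (\1_H : RT -> R) by exact: bounded_mfun_indic.
have sA := bounded_mfun_mp_ext bs bA; have sKb := bounded_mfun_mp_ext bs bK.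
have bAK : bounded_mfun (fun x : RT => `|\1_A x - \1_(cells R K) x| : R).
  exact: bounded_mfun_indic_dist.
have bsAK := bounded_mfun_mp_ext bs bAK.
have bLH : bounded_mfun (fun x : RT => `|\1_L x - \1_H x| : R).
  exact: bounded_mfun_indic_dist.
have KL (x : R) : 0 <= x < 1 -> \1_(cells R K) (mp_ext s x) = \1_L x :> R.
  move=> x01; have Ux : U x.
    by move/andP: x01 => [x0 /ltW x1]; rewrite /unit_itv /= in_itv /= x0.
  rewrite mp_extE// !indicE; congr (_ %:R); congr nat_of_bool.
  have LE : L x <-> x < k by rewrite /L /= in_itv /=; case/andP: x01 => -> _.
  by apply/idP/idP; rewrite !inE => ?; [apply/LE/sK|apply/sK => //; apply/LE].
have JK : J (fun x => \1_(cells R K) (mp_ext s x)) = J \1_L by exact: eq_intU_lt1.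
have JLA : `|J \1_L - J \1_A| <= eps / 2.
  by rewrite -JK intU_mp_ext// distrC; apply: le_trans AK; exact: norm_intUB_le.
(* Initial intervals are nested, so their L1 distance is the difference of their measures. *)
have JLH : J (fun x => `|\1_L x - \1_H x|) = `|J \1_L - J \1_H|.
  have nested (a b : R) x : a <= b ->
      \1_(`[0, a[%classic : set RT) x <= (\1_(`[0, b[%classic : set RT) x : R).
    move=> ab; rewrite !indicE ler_nat; case: (boolP (x \in `[0, a[%classic)) => //.
    rewrite inE /= in_itv /= => /andP[x0 xa]; rewrite mem_set//= in_itv /= x0.
    exact: lt_le_trans ab.
  have [k2|k2] := leP k (1 / 2).
    have LH x : \1_L x <= (\1_H x : R) by exact: nested.
    rewrite ler0_norm ?subr_le0; last exact: le_intU.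
    by rewrite opprB -intUB//; apply: eq_intU => x _;
      rewrite distrC ger0_norm ?subr_ge0.
  have LH x : \1_H x <= (\1_L x : R) by apply: nested; exact: ltW.
  rewrite ger0_norm ?subr_ge0; last exact: le_intU.
  by rewrite -intUB//; apply: eq_intU => x _; rewrite ger0_norm ?subr_ge0.
apply: (@le_trans _ _ (J (fun x => `|\1_A (mp_ext s x) - \1_(cells R K) (mp_ext s x)|
   + `|\1_(cells R K) (mp_ext s x) - \1_H x|))).
  apply: le_intU.
  - by apply/bounded_mfun_norm/bounded_mfunB.
  - by apply: bounded_mfunD => //; apply/bounded_mfun_norm/bounded_mfunB.
  - by move=> x _; exact: ler_distD.
rewrite intUD//; last exact/bounded_mfun_norm/bounded_mfunB.
rewrite (intU_mp_ext bs bAK).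
have -> : J (fun x => `|\1_(cells R K) (mp_ext s x) - \1_H x|) =
    J (fun x => `|\1_L x - \1_H x|).
  by apply: eq_intU_lt1 => //; [exact/bounded_mfun_norm/bounded_mfunB|move=> x x01;
    rewrite KL].
rewrite JLH intU_indic_half; have := ler_distD (J \1_A) (J \1_L) (1 / 2).
by move: JLA AK; lra.
Qed.

End CutDistance.

(** * Graphons and the cut distance *)

Section GraphonKernels.
Context (R : realType).
Local Notation RT := (measurableTypeR R).
Local Notation mu := (@lebesgue_measure R).
Local Notation mu2 := (mu \x mu)%E.
Local Notation U := (@unit_itv R).
Local Notation sq := (@unit_sq R).
Local Notation J := (@intU R).
Local Notation J2 := (@intU2 R).

(** A graphon is unconstrained off the unit square; extension by zero makes measurability, symmetry
    and bounds global, as [kernel01] requires. *)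
Definition ext (f : graphon R) : RT * RT -> R := (f : RT * RT -> R) \_ sq.

Lemma extE (f : graphon R) x y : U x -> U y -> ext f (x, y) = f (x, y).
Proof. by move=> Ux Uy; rewrite /ext patch_sq. Qed.

Lemma ext_kernel01 (f : graphon R) : kernel01 (ext f).
Proof.
have [mf symf f01] := graphonP f.
have F01 p : 0 <= ext f p <= 1.
  rewrite /ext patchE; case: ifP; last by rewrite lexx ler01.
  by case: p => x y; rewrite inE => -[Ux Uy]; exact: f01.
split => //.
- split; first exact: measurable_ext.
  by exists 1 => p; have /andP[p0 p1] := F01 p; rewrite ger0_norm.
- move=> x y; rewrite /ext !patchE !in_setX /= andbC.
  by case: ifP => // /andP[]; rewrite !inE => Ux Uy; exact: symf.
Qed.

Lemma bounded_mfun_ext (f : graphon R) : bounded_mfun (ext f).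
Proof. by case: (ext_kernel01 f). Qed.

Lemma ext01 (f : graphon R) p : 0 <= ext f p <= 1.
Proof. by case: (ext_kernel01 f). Qed.

Transparent intU.

(** With [intU] transparent, the cube integral is an iterated [intU] by conversion; what remains is
    to compute the product over pairs i < j. *)
Lemma hom_density_K2 (f : graphon R) :
  hom_density (complete 2) f = edge_density (ext f).
Proof.
rewrite /hom_density /edge_density /intU2 /=.
apply: eq_intU => x Ux; apply: eq_intU => y Uy; rewrite extE//.
rewrite big_mkcond -(pair_bigA _ (fun i j : 'I_2 =>
  if (i < j)%N && (i != j)
    then f (tnth [tuple x; y] i, tnth [tuple x; y] j) else 1)) /=.
rewrite !big_ord_recl !big_ord0 /=.
by rewrite !mulr1 !mul1r.
Qed.

Lemma hom_density_K3 (f : graphon R) :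
  hom_density (complete 3) f = triangle_density (ext f).
Proof.
rewrite /hom_density /triangle_density /intU3 /intU2 /=.
apply: eq_intU => x Ux; apply: eq_intU => y Uy; apply: eq_intU => z Uz;
  rewrite /= !extE//.
rewrite big_mkcond -(pair_bigA _ (fun i j : 'I_3 =>
  if (i < j)%N && (i != j)
    then f (tnth [tuple x; y; z] i, tnth [tuple x; y; z] j) else 1)) /=.
rewrite !big_ord_recl !big_ord0 /=.
by rewrite !mulr1 !mul1r.
Qed.

Opaque intU.

Lemma Rintegral_rect_intU2 (h : RT * RT -> R) A B : bounded_mfun h ->
  measurable A -> measurable B -> A `<=` U -> B `<=` U ->
  \int[mu2]_(z in A `*` B) h z = J2 (fun p => h p * (\1_A p.1 * \1_B p.2)).
Proof.
move=> bh mA mB AU BU.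
have bAB : bounded_mfun (fun p : RT * RT => \1_A p.1 * \1_B p.2 : R) by solve_bm.
rewrite /intU2 -(@Rintegral_intU R (fun p => h p * (\1_A p.1 * \1_B p.2)));
  last exact: bounded_mfunM.
rewrite [LHS]Rintegral_mkcond [RHS]Rintegral_mkcond; apply: eq_Rintegral => -[x y] _.
rewrite !patchE !in_setX !indicE /=.
case: (boolP (x \in A)) => xA /=; last by rewrite mul0r mulr0; case: ifP.
case: (boolP (y \in B)) => yB /=; last by rewrite !mulr0; case: ifP.
by rewrite !mulr1 !mem_set//; [apply: BU|apply: AU]; exact: set_mem.
Qed.

Lemma cut_norm_le_intU2 (h : RT * RT -> R) : bounded_mfun h ->
  cut_norm h <= J2 (fun p => `|h p|).
Proof.
move=> bh; apply: cut_norm_le; first exact: bounded_mfun_bmfun.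
move=> A B mA mB AU BU; rewrite Rintegral_rect_intU2//.
have bAB : bounded_mfun (fun p : RT * RT => \1_A p.1 * \1_B p.2 : R) by solve_bm.
have bhAB := bounded_mfunM bh bAB; have bn := bounded_mfun_norm bh.
have main x y : `|h (x, y) * (\1_A x * \1_B y)| <= `|h (x, y)|.
  rewrite normrM ler_piMr// ger0_norm.
    by rewrite mulr_ile1//; case/andP: (indic01 A x); case/andP: (indic01 B y).
  by rewrite mulr_ge0.
rewrite ler_norml; apply/andP; split.
  rewrite lerNl -mulN1r -intU2Z//; apply: le_intU2 => //;
    first by apply: bounded_mfunM => //; exact: bounded_mfun_cst.
  by move=> x y _ _; rewrite mulN1r; apply: le_trans (main x y);
    rewrite -normrN ler_norm.
apply: le_intU2 => // x y _ _.
by apply: le_trans (main x y); exact: ler_norm.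
Qed.

Lemma bounded_mfun_mp_ext2 s (h : RT * RT -> R) : mp_bij s -> bounded_mfun h ->
  bounded_mfun (fun p => h (mp_ext2 s p)).
Proof. by move=> bs; apply: bounded_mfun_comp; exact: measurable_mp_ext2. Qed.

Lemma intU2_mp_ext2 s (h : RT * RT -> R) : mp_bij s -> bounded_mfun h ->
  J2 (fun p => h (mp_ext2 s p)) = J2 h.
Proof.
move=> bs bh; rewrite /intU2 -(intU_mp_ext bs (bounded_mfun_intU bh)); congr J;
  apply/funext => x.
by rewrite -(intU_mp_ext bs (bounded_mfun_section (mp_ext s x) bh)).
Qed.

Lemma cut_dist_le_intU2 (f g : graphon R) s : mp_bij s ->
  cut_dist f g <= J2 (fun p => `|ext f (mp_ext2 s p) - ext g p|).
Proof.
move=> bs; apply: le_trans (cut_dist_le f g bs (@mp_bij_id R)) _.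
have bf := bounded_mfun_mp_ext2 bs (bounded_mfun_ext f).
apply: le_trans (cut_norm_le_intU2 (bounded_mfunB bf (bounded_mfun_ext g))).
rewrite le_eqVlt; apply/orP; left; apply/eqP; apply: eq_cut_norm => x y Ux Uy /=.
by rewrite extE// -(relabel_ext f bs Ux Uy).
Qed.

Lemma intU2_fst (h : RT -> R) : J2 (fun p => h p.1) = J h.
Proof. by rewrite /intU2; congr J; apply/funext => x; rewrite /= intU_cst. Qed.

Lemma intU2_snd (h : RT -> R) : J2 (fun p => h p.2) = J h.
Proof. by rewrite /intU2 /= intU_cst. Qed.

Lemma bip_dist (A B : set RT) x y x' y' :
  `|bip A (x, y) - bip B (x', y')| <= `|\1_A x - \1_B x'| + `|\1_A y - \1_B y'| :> R.
Proof.
rewrite /bip /= !indicE.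
by do 4!(case: (_ \in _)) => /=;
  rewrite ?(mulr1n, mulr0n, subrr, subr0, sub0r, normrN, normr0, normr1) ?ler_norml;
    lra.
Qed.

(** The ceiling makes the classes closed on the right, and puts the point 0 in a class of its own;
    hence the restriction to positive coordinates. *)
Lemma turan2E (x y : RT) : 0 < (x : R) <= 1 -> 0 < (y : R) <= 1 ->
  turan 2 (x, y) = bip (`]0, 1/2]%classic : set RT) (x, y) :> R.
Proof.
have c (z : R) : 0 < z <= 1 -> Num.ceil (z * 2) = if z <= 1/2 then 1 else 2.
  move=> /andP[z0 z1]; apply: ceil_def; case: ifP => hz.
    by apply/andP; split; rewrite ?subrr; lra.
  move/negbT: hz; rewrite -ltNge => hz.
  have e1 : (2 - 1 : int) = 1 by [].
  rewrite e1; apply/andP; split; lra.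
move=> x01 y01; rewrite /= /turan_fun /= !c// /bip /= !indicE.
have i (z : R) : 0 < z <= 1 -> (z \in (`]0, 1/2]%classic : set R)) = (z <= 1/2).
  by move=> /andP[z0 _]; apply/idP/idP; rewrite inE /= in_itv /= z0.
rewrite !i//; case: (leP (x : R)) => _; case: (leP (y : R)) => _ /=;
  rewrite ?eqxx ?mulr1 ?mulr0 ?mulr1n ?mulr0n; lra.
Qed.

End GraphonKernels.

(** * Edge and triangle densities against the cut distance *)

Section Stability.
Context (R : realType).
Local Notation RT := (measurableTypeR R).
Local Notation mu := (@lebesgue_measure R).
Local Notation mu2 := (mu \x mu)%E.
Local Notation U := (@unit_itv R).
Local Notation J := (@intU R).
Local Notation J2 := (@intU2 R).
Local Notation J3 := (@intU3 R).
Local Notation H := (`[0, 1 / 2[%classic : set RT).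

Lemma edge_densityE (f : graphon R) : edge_density (ext f) =
  \int[mu2]_(z in U `*` U) f z.
Proof.
rewrite /edge_density /intU2 -(Rintegral_intU (bounded_mfun_ext f));
  apply: eq_Rintegral => -[x y].
by rewrite inE => -[Ux Uy]; exact: extE.
Qed.

Lemma mp_bij_imageU s : mp_bij s -> s @` U = U.
Proof.
move=> [[fs _ ss] _ _ _]; apply/seteqP; split=> x /=; first by move=> [y Uy <-];
  exact: fs.
by move=> Ux; have [y Uy <-] := ss _ Ux; exists y.
Qed.

(** Test the cut norm on the whole square, where relabeling does not change the integral. At cut
    distance 0 this gives the edge density of any representative. *)
Lemma edge_density_cut (f g : graphon R) :
  `|edge_density (ext f) - edge_density (ext g)| <= cut_dist f g.
Proof.
apply: lb_le_inf; first by case: (cut_dist_vals_has_inf f g).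
move=> _ [s [t [bs bt ->]]].
have bf := relabel_graphon_bmfun f bs; have bg := relabel_graphon_bmfun g bt.
have := cut_norm_ub (bmfunB bf bg) (@mU R) (@mU R) (@subset_refl _ _)
  (@subset_refl _ _).
congr (_ <= _); congr `|_|.
have mUU : measurable (U `*` U) by apply: measurableX; exact: mU.
rewrite RintegralB//; [|exact: bmfun_integrable (@mU R) (@mU R) _ _..].
rewrite !Rintegral_relabel//;
  [|exact: graphon_bmfun (graphonP _)|exact: mU|exact: mU|exact: graphon_bmfun
    (graphonP _)|exact: mU|exact: mU].
by rewrite !mp_bij_imageU// !edge_densityE.
Qed.

(** Pigeonhole: two of three vertices lie on the same side of [B], so every triangle has a
    monochromatic edge; the factor 3 counts the positions of that edge. *)
Lemma triangle_density_le_monochromatic (F : RT * RT -> R) (B : set RT) :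
  kernel01 F -> measurable B ->
  triangle_density F <= 3 * (J2 (fun p => F p * (\1_B p.1 * \1_B p.2)) +
                             J2 (fun p => F p * ((1 - \1_B p.1) * (1 - \1_B p.2)))).
Proof.
move=> [bF symF F01] mB.
rewrite -intU2D; [|by solve_bm..].
pose W p := F p * (\1_B p.1 * \1_B p.2) + F p * ((1 - \1_B p.1) * (1 - \1_B p.2)).
have bW : bounded_mfun W by rewrite /W; solve_bm.
have -> : 3 * J2 W = J3 (fun p => W (p.1.1, p.1.2)) + J3 (fun p => W (p.1.1, p.2))
   + J3 (fun p => W (p.1.2, p.2)).
  by rewrite intU3_xy intU3_xz intU3_yz /edge_density; ring.
have bW1 : bounded_mfun (fun p : RT * RT * RT => W (p.1.1, p.1.2)) by solve_bm.
have bW2 : bounded_mfun (fun p : RT * RT * RT => W (p.1.1, p.2)) by solve_bm.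
have bW3 : bounded_mfun (fun p : RT * RT * RT => W (p.1.2, p.2)) by solve_bm.
have bW12 := bounded_mfunD bW1 bW2.
rewrite -intU3D; [|exact: bW1|exact: bW2].
rewrite -intU3D; [|exact: bW12|exact: bW3].
apply: le_intU3; [by solve_bm|exact: bounded_mfunD bW12 bW3|].
move=> x y z _ _ _ /=; rewrite /W /= !indicE.
have := F01 (x, y); have := F01 (x, z); have := F01 (y, z).
move: (F (x, y)) (F (x, z)) (F (y, z)) => u v w.
move=> /andP[w0 w1] /andP[v0 v1] /andP[u0 u1].
have uv : u * v <= u by rewrite ler_piMr.
have uv' : u * v <= v by rewrite ler_piMl.
have uvw : u * v * w <= u * v by rewrite ler_piMr// mulr_ge0.
have uvw' : u * v * w <= w by rewrite ler_piMl// mulr_ile1.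
by do 3!(case: (_ \in _)) => /=; lra.
Qed.

Lemma intU3_mp_ext s (h : RT * RT * RT -> R) : mp_bij s -> bounded_mfun h ->
  J3 (fun p => h (mp_ext2 s p.1, mp_ext s p.2)) = J3 h.
Proof.
move=> bs bh; rewrite /intU3 -(intU2_mp_ext2 bs (bounded_mfun_intU bh)); congr J2;
  apply/funext => p.
by rewrite -(intU_mp_ext bs (bounded_mfun_section (mp_ext2 s p) bh)).
Qed.

Lemma bip_is_graphon (A : set RT) : measurable A -> is_graphon (bip A : RT * RT -> R).
Proof.
move=> mA; have [mb _] := bounded_mfun_bip mA; split; first exact: measurable_funTS.
  by move=> x y _ _; rewrite /bip /=; ring.
by move=> x y _ _; have [->|->] := bip_values A (x, y); rewrite ?lexx ?ler01.
Qed.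

Lemma measurable_half : measurable H.
Proof. exact: measurable_itv. Qed.

(** The bipartite competitor; it agrees with [turan 2] unless a coordinate is 0 or 1/2, and its edge
    density follows from [edge_density_bip]. *)
Definition bip_half : graphon R := Graphon (bip_is_graphon measurable_half).

Lemma edge_density_bip (A : set RT) : measurable A ->
  edge_density (bip A : RT * RT -> R) = 2 * J \1_A - 2 * J \1_A ^+ 2.
Proof.
move=> mA; rewrite /edge_density /bip.
have bA : bounded_mfun (\1_A : RT -> R) by exact: bounded_mfun_indic.
rewrite intU2B; [|by solve_bm..].
rewrite intU2D; [|by solve_bm..].
rewrite intU2Z; [|by solve_bm..].
rewrite intU2_fst intU2_snd.
have -> : J2 (fun p => \1_A p.1 * \1_A p.2) = J \1_A ^+ 2.
  rewrite /intU2 expr2 -intUZr//; congr J; apply/funext => x; by rewrite /= intUZ.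
ring.
Qed.

Lemma edge_density_bip_half : edge_density (ext bip_half) = 1 / 2.
Proof.
rewrite (_ : edge_density _ = edge_density (bip H : RT * RT -> R)).
  by rewrite edge_density_bip ?intU_indic_half; [field|exact: measurable_half].
by apply: eq_intU2 => x y Ux Uy; rewrite extE.
Qed.

(** The relabeled bipartite graphon vanishes on B x B and on the square of the complement, so the
    monochromatic mass of [g] on each is at most the cut norm; three positions times two sides give
    6. *)
Lemma triangle_density_cut_bip_half (g : graphon R) :
  triangle_density (ext g) <= 6 * cut_dist g bip_half.
Proof.
rewrite mulrC -ler_pdivrMr//; apply: lb_le_inf.
  by case: (cut_dist_vals_has_inf g bip_half).
move=> _ [s [t [bs bt ->]]]; rewrite ler_pdivrMr//.
have kg := ext_kernel01 g; have [bg symg g01] := kg.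
pose G p := ext g (mp_ext2 s p).
have bG : bounded_mfun G by exact: bounded_mfun_mp_ext2.
have kG : kernel01 G by split=> [//|x y|p]; [exact: symg|exact: g01].
have -> : triangle_density (ext g) = triangle_density G.
  rewrite /triangle_density.
  rewrite -(@intU3_mp_ext s (fun p =>
    ext g (p.1.1, p.1.2) * ext g (p.1.1, p.2) * ext g (p.1.2, p.2)) bs)//.
  by solve_bm.
pose B := mp_ext t @^-1` H.
have mB : measurable B.
  by rewrite -[B]setTI; apply: (measurable_mp_ext bt) => //; exact: measurable_half.
apply: le_trans (triangle_density_le_monochromatic kG mB) _.
have bf := relabel_graphon_bmfun g bs; have bb := relabel_graphon_bmfun bip_half bt.
have key (D : set RT) : measurable D -> D `<=` U ->
    (forall x y, D x -> D y -> (x \in B) = (y \in B)) ->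
    J2 (fun p => G p * (\1_D p.1 * \1_D p.2)) <=
    cut_norm (relabel s g \- relabel t bip_half).
  move=> mD DU DB; rewrite -Rintegral_rect_intU2//.
  apply: le_trans (cut_norm_ub (bmfunB bf bb) mD mD DU DU).
  apply: le_trans (ler_norm _).
  rewrite le_eqVlt; apply/orP; left; apply/eqP; apply: eq_Rintegral => -[x y].
  rewrite inE => -[/= Dx Dy]; rewrite /G /ext (relabel_ext g bs (DU _ Dx) (DU _ Dy)).
  rewrite [relabel t _ _](_ : _ = 0) ?subr0//.
  rewrite /relabel /= -(mp_extE t (DU _ Dx)) -(mp_extE t (DU _ Dy)) /bip /= !indicE.
  have HB z : (mp_ext t z \in H) = (z \in B) by apply/idP/idP; rewrite !inE.
  by rewrite !HB (DB x y)//; case: (_ \in _) => /=; ring.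
have k1 : J2 (fun p => G p * (\1_B p.1 * \1_B p.2)) <=
    cut_norm (relabel s g \- relabel t bip_half).
  apply: le_trans (key (B `&` U) _ _ _).
  - rewrite le_eqVlt; apply/orP; left; apply/eqP; apply: eq_intU2 => x y Ux Uy.
    by rewrite /= !indicE !in_setI !(mem_set Ux) !(mem_set Uy) !andbT.
  - by apply: measurableI => //; exact: mU.
  - exact: subIsetr.
  - by move=> x y [Bx _] [By _]; rewrite !mem_set.
have k2 : J2 (fun p => G p * ((1 - \1_B p.1) * (1 - \1_B p.2))) <=
    cut_norm (relabel s g \- relabel t bip_half).
  apply: le_trans (key (U `\` B) _ _ _).
  - rewrite le_eqVlt; apply/orP; left; apply/eqP; apply: eq_intU2 => x y Ux Uy.
    rewrite /= !indicE !in_setD !(mem_set Ux) !(mem_set Uy) /=.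
    by case: (x \in B); case: (y \in B) => /=; ring.
  - by apply: measurableD => //; exact: mU.
  - exact: subDsetl.
  - by move=> x y [_ Bx] [_ By]; rewrite !memNset.
by move: k1 k2; move: (J2 _) (J2 _) (cut_norm _) => u v w; lra.
Qed.

End Stability.

(** * Stability *)

Section RealInequalities.
Context (R : realType).
Implicit Types u v w d t gamma : R.

(** The concave function - v ln v lies below its tangent at [d]. *)
Lemma mul_ln_gap v d : 0 <= v -> 0 < d -> v * (ln d - ln v) <= d - v.
Proof.
rewrite le_eqVlt => /predU1P[<- d0|v0 d0]; first by rewrite mul0r subr0 ltW.
rewrite -ln_div ?posrE// (_ : d / v = 1 + (d / v - 1)); last by rewrite addrC subrK.
have dv : -1 < d / v - 1 by rewrite ltrBrDr addrC subrr divr_gt0.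
apply: (@le_trans _ _ (v * (d / v - 1))); first by rewrite ler_pM2l// le_ln1Dx.
by rewrite mulrBr mulr1 mulrC divfK ?gt_eqF.
Qed.

Lemma rate_le0 u : 0 <= u <= 1 -> rate u <= 0.
Proof.
move=> /andP[u0 u1]; rewrite /rate.
have h1 : u * ln u <= 0 by rewrite mulr_ge0_le0// ln_le0.
have h2 : (1 - u) * ln (1 - u) <= 0.
  by rewrite mulr_ge0_le0// ?subr_ge0// ln_le0// gerBl.
lra.
Qed.

(** Entropy has infinite slope at 0 and 1; a tangent at [d] trades this for a small constant plus a
    bound linear in the distance, which can be integrated. The other term uses the tangent at 1. *)
Lemma rate_ge_dist01 u v d : 0 <= u <= 1 -> v = 0 \/ v = 1 -> 0 < d <= 1 ->
  - rate u <= d + (1 - ln d) * `|u - v|.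
Proof.
move=> /andP[u0 u1] v01 /andP[d0 d1]; have lnd := ln_le0 d1.
have u1' : 0 <= 1 - u by rewrite subr_ge0.
have A := mul_ln_gap u0 d0; have B := mul_ln_gap u1' d0.
have A1 := mul_ln_gap u0 (@ltr01 R); have B1 := mul_ln_gap u1' (@ltr01 R).
rewrite ln1 in A1 B1.
have C : u * ln d <= 0 by rewrite mulr_ge0_le0.
have D : (1 - u) * ln d <= 0 by rewrite mulr_ge0_le0.
rewrite /rate; move: A B A1 B1 C D.
move: (ln u) (ln (1 - u)) (ln d) lnd => p q r *.
case: v01 => ->.
  by rewrite subr0 ger0_norm//; lra.
by rewrite ler0_norm ?subr_le0//; lra.
Qed.

(* With edge density e = (1 + w) / 2, Goodman's bound t >= e w and AM-GM in the
   form e >= sqrt w give t >= w^(3/2), hence t^gamma >= w^(5/6). *)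
Lemma powR_triangle_gap gamma t w : 0 < gamma -> gamma <= 5 / 9 ->
  0 <= w <= 1 -> (1 + w) / 2 * w <= t -> t <= 1 ->
  w + w * (1 - w) / 6 <= t `^ gamma.
Proof.
move=> g0 g59 /andP[]; rewrite le_eqVlt => /predU1P[<- _ _ _|w0 w1 tw t1].
  by rewrite !mul0r addr0 powR_ge0.
have e0 : 0 < (1 + w) / 2 by lra.
have t0 : 0 < t by apply: lt_le_trans tw; rewrite mulr_gt0.
have lnt : ln t <= 0 by exact: ln_le0.
have lne : ln w <= 2 * ln ((1 + w) / 2).
  rewrite mulr_natl -lnXn// ler_ln ?posrE ?exprn_gt0//.
  by have := sqr_ge0 (1 - w); nra.
have lntw : ln ((1 + w) / 2) + ln w <= ln t.
  by rewrite -lnM ?posrE// ler_ln ?posrE// mulr_gt0.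
have lnw : ln w <= w - 1.
  have := @le_ln1Dx R (w - 1); rewrite (_ : 1 + (w - 1) = w); last by ring.
  by apply; lra.
have gt : 5 / 6 * ln w <= gamma * ln t.
  have : 5 / 9 * ln t <= gamma * ln t by rewrite ler_wnM2r.
  by lra.
rewrite /powR gt_eqF//; apply: le_trans (_ : expR (5 / 6 * ln w) <= _); last first.
  by rewrite ler_expR.
(* Write w^(5/6) as w exp(- ln w / 6); then exp s >= 1 + s and - ln w >= 1 - w produce the gap. *)
rewrite (_ : 5 / 6 * ln w = ln w + - ln w / 6); last by field.
rewrite expRD lnK ?posrE//.
apply: (@le_trans _ _ (w * (1 + - ln w / 6))); last first.
  by rewrite ler_pM2l// expR_ge1Dx.
rewrite -[X in X + _]mulr1 -mulrA -mulrDr ler_pM2l//; lra.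
Qed.

End RealInequalities.

(** * From densities to cut distance and entropy *)

Section NearOptimal.
Context (R : realType).
Local Notation RT := (measurableTypeR R).
Local Notation mu := (@lebesgue_measure R).
Local Notation U := (@unit_itv R).
Local Notation J := (@intU R).
Local Notation J2 := (@intU2 R).
Local Notation H := (`[0, 1 / 2[%classic : set RT).

Lemma bounded_mfun_rate (f : graphon R) : bounded_mfun (fun p => rate (ext f p)).
Proof.
have [mF _] := bounded_mfun_ext f; split.
  rewrite /rate; apply: measurable_funD; apply: measurable_funM => //.
    by apply: measurable_funM => //; apply: measurableT_comp => //;
      exact: measurable_ln.
  apply: measurable_funM => //; first exact: measurable_funB.
  by apply: measurableT_comp => //; exact: measurable_funB.
exists 2 => p; have F01 := ext01 f p.
rewrite ler0_norm ?rate_le0//; have h : 0 < (1 : R) <= 1 by rewrite ltr01 lexx.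
apply: le_trans (rate_ge_dist01 F01 (or_introl (erefl 0)) h) _.
by rewrite ln1 !subr0 mul1r; move/andP: F01 => [? ?]; rewrite ger0_norm//; lra.
Qed.

Lemma graphon_rateE (f : graphon R) :
  graphon_rate f = J2 (fun p => rate (ext f p)).
Proof.
rewrite /graphon_rate /intU2 -(Rintegral_intU (bounded_mfun_rate f));
  apply: eq_Rintegral => -[x y].
by rewrite inE => -[Ux Uy]; rewrite extE.
Qed.

Lemma graphon_rate_le0 (f : graphon R) : graphon_rate f <= 0.
Proof.
rewrite graphon_rateE -[leRHS]intU2_cst; apply: le_intU2;
  [exact: bounded_mfun_rate|exact: bounded_mfun_cst|].
by move=> x y _ _; exact/rate_le0/ext01.
Qed.

Lemma graphon_rate_ge (f : graphon R) (G : RT * RT -> R) (d : R) :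
  bounded_mfun G -> (forall p, G p = 0 \/ G p = 1) -> 0 < d <= 1 ->
  - graphon_rate f <= d + (1 - ln d) * J2 (fun p => `|ext f p - G p|).
Proof.
move=> bG G01 d01; have bF := bounded_mfun_ext f; have br := bounded_mfun_rate f.
have bn : bounded_mfun (fun p => `|ext f p - G p|) by solve_bm.
rewrite graphon_rateE -mulN1r -intU2Z// -intU2Z// -[X in X + _]intU2_cst -intU2D;
  last 2 first.
- exact: bounded_mfun_cst.
- by apply: bounded_mfunM => //; exact: bounded_mfun_cst.
apply: le_intU2; [by apply: bounded_mfunM => //; exact: bounded_mfun_cst|by solve_bm|].
by move=> x y _ _; rewrite mulN1r; apply: rate_ge_dist01 => //; exact: ext01.
Qed.

(** Since f <= 1, the L1 distance to 1 is the edge deficit. Here [d] makes the constant part of the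
    entropy bound at most [eps / 2], and [delta] absorbs the factor [1 - ln d] into the other
    half. *)
Lemma near_const1 (eps : R) : 0 < eps -> exists2 delta, 0 < delta &
  forall f : graphon R, 1 - delta <= edge_density (ext f) ->
  cut_dist f const1 <= eps /\ - graphon_rate f <= eps.
Proof.
move=> eps0; pose d := Num.min 1 (eps / 2).
have d0 : 0 < d by rewrite lt_min ltr01 divr_gt0.
have d1 : d <= 1 by rewrite ge_min lexx.
have dl : d <= eps / 2 by rewrite ge_min lexx orbT.
have C0 : 1 <= 1 - ln d by rewrite lerBrDr gerDl ln_le0.
have C1 : 0 < 1 - ln d by exact: lt_le_trans C0.
exists (eps / 2 / (1 - ln d)); first by rewrite !divr_gt0.
move=> f; rewrite lerBlDr -lerBlDl => fe.
have bF := bounded_mfun_ext f.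
have eE : J2 (fun p => `|ext f p - 1|) = 1 - edge_density (ext f).
  transitivity (J2 (fun p => 1 - ext f p)).
    apply: eq_intU2 => x y _ _; have /andP[_ F1] := ext01 f (x, y).
    by rewrite /= ler0_norm ?subr_le0// opprB.
  by rewrite (intU2B (bounded_mfun_cst _ 1) bF) intU2_cst.
split.
  apply: le_trans (cut_dist_le_intU2 f const1 (@mp_bij_id R)) _.
  rewrite (_ : J2 _ = 1 - edge_density (ext f)).
    apply: le_trans fe _; rewrite ler_pdivrMr//; nra.
  rewrite -eE; apply: eq_intU2 => x y Ux Uy.
  by rewrite /mp_ext2 /= !mp_extE// !extE.
have b1 : bounded_mfun (fun p : RT * RT => 1 : R) by exact: bounded_mfun_cst.
have d01 : 0 < d <= 1 by rewrite d0.
have := graphon_rate_ge f b1 (fun=> or_intror (erefl _)) d01.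
rewrite eE; move: fe; rewrite ler_pdivlMr// mulrC => fe; lra.
Qed.

Lemma intU_indic_countable (Z : set RT) : countable Z -> measurable Z ->
  J \1_Z = 0.
Proof.
move=> cZ mZ; rewrite intU_indic// (_ : mu _ = 0%E)//.
by apply: countable_lebesgue_measure0;
  exact: sub_countable (subset_card_le (@subIsetl _ _ _)) cZ.
Qed.

Lemma cut_dist_turan2_le (f : graphon R) (A : set RT) (eps : R) :
  measurable A -> 0 < eps ->
  cut_dist f (turan 2) <= J2 (fun p => `|ext f p - bip A p|) +
    2 * `|J \1_A - 1 / 2| + eps.
Proof.
move=> mA eps0; have eps20 : 0 < eps / 2 by rewrite divr_gt0.
have [s bs sA] := rearrange_half mA eps20.
apply: le_trans (cut_dist_le_intU2 f (turan 2) bs) _.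
(* The null set of coordinates where the classes of [turan 2] and the half-open interval [H]
   disagree; there the error, at most 1, is charged to [\1_Z]. *)
pose Z : set RT := [set 0; 1 / 2].
have mZ : measurable Z by exact: measurableU.
have Z0 : J \1_Z = 0 by apply: intU_indic_countable => //;
  exact/finite_set_countable/finite_set2.
have bF := bounded_mfun_ext f; have bA := bounded_mfun_bip mA.
pose h p := `|ext f p - bip A p|.
have bh : bounded_mfun h by rewrite /h; solve_bm.
have bhs := bounded_mfun_mp_ext2 bs bh.
pose k (x : RT) : R := `|\1_A (mp_ext s x) - \1_H x| + \1_Z x.
have b1 := bounded_mfun_mp_ext bs (bounded_mfun_indic R mA).
have bn : bounded_mfun (fun x : RT => `|\1_A (mp_ext s x) - \1_H x| : R).
  by apply: bounded_mfun_norm; apply: bounded_mfunB => //; apply: bounded_mfun_indic;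
    exact: measurable_half.
have bk : bounded_mfun k by apply: bounded_mfunD => //; exact: bounded_mfun_indic.
have bk1 : bounded_mfun (fun p : RT * RT => k p.1)
  by exact: (@bounded_mfun_comp _ _ _ _ _ fst).
have bk2 : bounded_mfun (fun p : RT * RT => k p.2)
  by exact: (@bounded_mfun_comp _ _ _ _ _ snd).
have Jk : J k <= `|J \1_A - 1 / 2| + eps / 2.
  by rewrite /k intUD//; [rewrite Z0 addr0|exact: bounded_mfun_indic].
apply: (@le_trans _ _ (J2 (fun p => h (mp_ext2 s p) + k p.1 + k p.2))); last first.
  have bhk := bounded_mfunD bhs bk1.
  rewrite intU2D; [|exact: bhk|exact: bk2]; rewrite intU2D; [|exact: bhs|exact: bk1].
  rewrite intU2_fst intU2_snd (intU2_mp_ext2 bs bh).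
  by move: Jk; rewrite -/h; lra.
have bT := bounded_mfun_ext (turan 2).
apply: le_intU2.
- by apply/bounded_mfun_norm/bounded_mfunB => //; exact: bounded_mfun_mp_ext2.
- exact: bounded_mfunD (bounded_mfunD bhs bk1) bk2.
move=> x y Ux Uy.
have k0 z : 0 <= k z.
  by rewrite /k addr_ge0//; case/andP: (indic01 Z z).
have Zk z : Z z -> 1 <= k z.
  by move=> Zz; rewrite /k [\1_Z z]indicE (mem_set Zz) lerDr.
have small (z z' : RT * RT) : `|ext f z - ext (turan 2) z'| <= 1.
  have /andP[p0 p1] := ext01 f z; have /andP[q0 q1] := ext01 (turan 2) z'.
  by rewrite ler_norml; lra.
have h0 z : 0 <= h z by exact: normr_ge0.
have [Zx|Zx] := pselect (Z x).
  apply: le_trans (small _ _) _; have := Zk _ Zx.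
  by have := k0 y; have := h0 (mp_ext2 s (x, y)); rewrite /=; lra.
have [Zy|Zy] := pselect (Z y).
  apply: le_trans (small _ _) _; have := Zk _ Zy.
  by have := k0 x; have := h0 (mp_ext2 s (x, y)); rewrite /=; lra.
have good z : U z -> ~ Z z -> 0 < (z : R) <= 1 /\
    \1_(`]0, 1/2]%classic : set RT) z = \1_H z :> R.
  rewrite /unit_itv /= in_itv /= => /andP[z0 z1] nZ.
  have zn0 : z != 0 by apply/eqP => e; apply: nZ; left.
  have zn2 : z != 1 / 2 by apply/eqP => e; apply: nZ; right.
  have zp : 0 < z by rewrite lt_neqAle eq_sym zn0.
  split; first by rewrite zp z1.
  rewrite !indicE; congr (_ %:R); congr nat_of_bool.
  apply/idP/idP; rewrite !inE /= !in_itv /= zp z0 /=; last exact: ltW.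
  by move=> z2; rewrite lt_neqAle zn2.
have [x01 Hx] := good _ Ux Zx; have [y01 Hy] := good _ Uy Zy.
apply: (le_trans (ler_distD (bip A (mp_ext2 s (x, y))) _ _)).
rewrite -[leRHS]addrA; apply: lerD; first by [].
rewrite [ext (turan 2) _]extE// turan2E//.
apply: le_trans (bip_dist _ _ _ _ _ _) _.
rewrite /= /k Hx Hy.
by rewrite lerD// lerDl; [case/andP: (indic01 Z x)|case/andP: (indic01 Z y)].
Qed.

Lemma near_turan2 (eps : R) : 0 < eps -> exists2 delta, 0 < delta &
  forall f : graphon R, 1 / 2 - delta <= edge_density (ext f) ->
  triangle_density (ext f) <= delta ->
  cut_dist f (turan 2) <= eps /\ - graphon_rate f <= eps.
Proof.
move=> eps0; pose d := Num.min 1 (eps / 2).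
have d0 : 0 < d by rewrite lt_min ltr01 divr_gt0.
have d1 : d <= 1 by rewrite ge_min lexx.
have dl : d <= eps / 2 by rewrite ge_min lexx orbT.
have C0 : 1 <= 1 - ln d by rewrite lerBrDr gerDl ln_le0.
have C1 : 0 < 1 - ln d by exact: lt_le_trans C0.
(* [bip_stability] with e (1 - 2 e) <= 2 delta and slack delta gives 16 + 24 + 1 = 41. The edge
   density of [bip A] is 1/2 - 2 (|A| - 1/2)^2 and at least 1/2 - 42 delta, so (2 (|A| - 1/2))^2 <=
   84 delta; 336 is 4 times 84. *)
pose delta := Num.min (eps / 2 / (1 - ln d) / 41)
  (Num.min (eps / 4 / 41) (eps ^+ 2 / 336)).
have delta0 : 0 < delta.
  by rewrite /delta !lt_min !divr_gt0 ?exprn_gt0 ?ltr0n.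
exists delta => // f fe ft.
have D1 : 41 * delta * (1 - ln d) <= eps / 2.
  rewrite -ler_pdivlMr// mulrC -ler_pdivlMr// /delta ge_min lexx //.
have D2 : 41 * delta <= eps / 4.
  by rewrite mulrC -ler_pdivlMr// /delta ge_min ge_min lexx /= orbT.
have D3 : 84 * delta <= (eps / 2) ^+ 2.
  have : delta <= eps ^+ 2 / 336 by rewrite /delta !ge_min lexx /= !orbT.
  by rewrite exprMn; lra.
move: (delta) delta0 fe ft D1 D2 D3 => D D0 fe ft D1 D2 D3.
have /andP[e0 e1] := edge_density_itv (ext_kernel01 f).
have [A mA fA] := bip_stability (ext_kernel01 f) D0.
have fA41 : J2 (fun p => `|ext f p - bip A p|) <= 41 * D.
  apply: le_trans fA _;
    have : edge_density (ext f) * (1 - 2 * edge_density (ext f)) <= 2 * D by nra.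
  by lra.
have d01 : 0 < d <= 1 by rewrite d0.
split; last first.
  apply: le_trans (graphon_rate_ge f (bounded_mfun_bip mA) (bip_values A) d01) _.
  have := ler_wpM2l (ltW C1) fA41; lra.
have eps40 : 0 < eps / 4 by rewrite divr_gt0.
apply: le_trans (cut_dist_turan2_le f mA eps40) _.
have bF := bounded_mfun_ext f; have bA := bounded_mfun_bip mA.
have eA : edge_density (ext f) - edge_density (bip A : RT * RT -> R) <= 41 * D.
  rewrite -(intU2B bF bA); apply: le_trans fA41; apply: le_intU2;
    [exact: bounded_mfunB|by solve_bm|].
  by move=> x y _ _; exact: ler_norm.
rewrite edge_density_bip// in eA.
have : `|2 * (J \1_A - 1 / 2)| <= eps / 2.
  rewrite -(ler_pXn2r (n := 2)) ?nnegrE//; last by rewrite ltW// divr_gt0.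
  rewrite real_normK ?num_real//; apply: le_trans D3; nra.
by rewrite normrM ger0_norm//; lra.
Qed.

End NearOptimal.

(** * Maximizers *)

Section Maximizers.
Context (R : realType) (gamma : R).
Hypothesis gamma0 : 0 < gamma.
Hypothesis gamma59 : gamma <= 5 / 9.
Implicit Types (x y : rgraphon R) (a b c N : R).

Definition red_edge x := edge_density (ext (repr x)).
Definition red_tri x := triangle_density (ext (repr x)).
Definition red_entropy x := - graphon_rate (repr x).

Lemma objectiveE beta1 beta2 x : objective gamma beta1 beta2 x =
  beta1 * red_edge x + beta2 * red_tri x `^ gamma + red_entropy x.
Proof. by rewrite /objective hom_density_K2 hom_density_K3. Qed.

Lemma red_edge_itv x : 0 <= red_edge x <= 1.
Proof. exact/edge_density_itv/ext_kernel01. Qed.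

Lemma red_entropy_ge0 x : 0 <= red_entropy x.
Proof. by rewrite oppr_ge0 graphon_rate_le0. Qed.

Lemma red_entropy_le2 x : red_entropy x <= 2.
Proof.
have d1 : 0 < (1 : R) <= 1 by rewrite ltr01 lexx.
have b0 : bounded_mfun (fun p : measurableTypeR R * measurableTypeR R => 0 : R).
  exact: bounded_mfun_cst.
apply: le_trans (graphon_rate_ge (repr x) b0 (fun=> or_introl (erefl _)) d1) _.
rewrite ln1 subr0 mul1r (_ : intU2 _ = red_edge x).
  by have /andP[_] := red_edge_itv x; lra.
by apply: eq_intU2 => u v _ _; rewrite subr0 ger0_norm//;
  case/andP: (ext01 (repr x) (u, v)).
Qed.

Lemma red_tri_itv x : 0 <= red_tri x <= 1.
Proof. exact/triangle_density_itv/ext_kernel01. Qed.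

Lemma red_tri_pow_itv x : red_tri x <= red_tri x `^ gamma <= 1.
Proof.
have /andP[t0 t1] := red_tri_itv x;
  have g1 : gamma <= 1 by apply: le_trans gamma59 _; lra.
apply/andP; split; last first.
  have <- : 1 `^ gamma = 1 :> R by rewrite powR1.
  by apply: ge0_ler_powR => //; rewrite ?nnegrE// ltW.
have [->|tn0] := eqVneq (red_tri x) 0; first exact: powR_ge0.
by apply: ger1_powR => //; rewrite lt_neqAle eq_sym tn0 t0.
Qed.

Lemma red_tri_gap x : 0 <= 2 * red_edge x - 1 ->
  (2 * red_edge x - 1) + (2 * red_edge x - 1) * (1 - (2 * red_edge x - 1)) / 6
    <= red_tri x `^ gamma.
Proof.
set w := 2 * red_edge x - 1 => w0; have /andP[_ e1] := red_edge_itv x;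
  have /andP[_ t1] := red_tri_itv x.
apply: powR_triangle_gap => //; first by rewrite w0 /w; lra.
have := goodman (ext_kernel01 (repr x)); rewrite -/(red_edge x) -/(red_tri x).
by congr (_ <= _); rewrite /w; congr (_ * _); field.
Qed.

(** A real [sup] is an upper bound only for a bounded set, so the objective is first bounded by
    |beta1| + |beta2| + 2. *)
Lemma maximizer_ge beta1 beta2 x y : maximizers gamma beta1 beta2 x ->
  objective gamma beta1 beta2 y <= objective gamma beta1 beta2 x.
Proof.
rewrite /maximizers /= => ->; apply: sup_upper_bound; last by exists y.
split; first by exists (objective gamma beta1 beta2 y), y.
exists (`|beta1| + `|beta2| + 2) => _ [z _ <-]; rewrite objectiveE.
have /andP[e0 e1] := red_edge_itv z; have /andP[t0 t1] := red_tri_pow_itv z.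
have p0 := powR_ge0 (red_tri z) gamma.
apply: lerD; last exact: red_entropy_le2.
apply: lerD; apply: le_trans (ler_norm _) _; rewrite normrM ler_piMr// ger0_norm//.
Qed.

Lemma cut_dist_repr_pi (f : graphon R) :
  cut_dist (repr (\pi_(rgraphon R) f)%qT) f = 0.
Proof.
have : repr (\pi_(rgraphon R) f)%qT = f %[mod rgraphon R]%qT by rewrite reprK.
by move/eqmodP/eqP.
Qed.

Lemma maximizer_ge_bip beta1 beta2 x : maximizers gamma beta1 beta2 x ->
  beta1 / 2 <= beta1 * red_edge x + beta2 * red_tri x `^ gamma + red_entropy x.
Proof.
move=> mx; rewrite -objectiveE.
pose y : rgraphon R := (\pi_(rgraphon R) (bip_half R))%qT.
apply: le_trans (maximizer_ge y mx); rewrite objectiveE.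
have y0 : cut_dist (repr y) (bip_half R) = 0 by exact: cut_dist_repr_pi.
have ey : red_edge y = 1 / 2.
  have := edge_density_cut (repr y) (bip_half R).
  by rewrite y0 normr_le0 subr_eq0 edge_density_bip_half => /eqP.
have ty : red_tri y = 0.
  apply/eqP; rewrite eq_le; have /andP[-> _] := red_tri_itv y; rewrite andbT.
  by have := triangle_density_cut_bip_half (repr y); rewrite y0 mulr0.
rewrite ey ty powR0 ?gt_eqF// mulr0 addr0 mul1r lerDl.
exact: red_entropy_ge0.
Qed.

Lemma maximizer_ge_const1 beta1 beta2 x : beta2 <= 0 ->
  maximizers gamma beta1 beta2 x ->
  beta1 + beta2 <= beta1 * red_edge x + beta2 * red_tri x `^ gamma + red_entropy x.
Proof.
move=> b0 mx; rewrite -objectiveE.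
pose y : rgraphon R := (\pi_(rgraphon R) (const1 : graphon R))%qT.
apply: le_trans (maximizer_ge y mx); rewrite objectiveE.
have y0 : cut_dist (repr y) const1 = 0 by exact: cut_dist_repr_pi.
have ey : red_edge y = 1.
  have := edge_density_cut (repr y) const1.
  rewrite y0 normr_le0 subr_eq0 => /eqP; rewrite /red_edge => ->.
  rewrite -[RHS](intU2_cst 1); apply: eq_intU2 => u v Uu Uv.
  by rewrite extE.
rewrite ey mulr1 -[leLHS]addr0; apply: lerD; last exact: red_entropy_ge0.
rewrite lerD2l -[leLHS]mulr1; apply: ler_wnM2l => //.
by case/andP: (red_tri_pow_itv y).
Qed.

(** Reduces the limit to a uniform estimate on representatives; the cases of an empty set of
    distances are settled by the default value 0 of [sup] and [inf]. *)
Lemma max_cut_dist_cvg0 a b (V : set (graphon R)) :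
  (forall eps, 0 < eps -> exists K, forall beta2, K <= - beta2 ->
    forall x, maximizers gamma (a * beta2 + b) beta2 x ->
    exists2 g, V g & cut_dist (repr x) g <= eps) ->
  max_cut_dist gamma (a * beta2 + b) beta2 V @[beta2 --> -oo] --> 0.
Proof.
move=> VP; apply/cvgrPdist_le => eps eps0; have [K KP] := VP _ eps0.
exists (- K); split; first exact: num_real.
move=> beta2 /ltW; rewrite lerNr => /KP {}KP; rewrite sub0r normrN.
rewrite /max_cut_dist; set D := [set _ | _ in _].
have inf0 x : 0 <= rcut_dist_set x (reduced V).
  rewrite /rcut_dist_set;
    have [->|/set0P ne] := eqVneq [set rcut_dist x u | u in reduced V] set0.
    by rewrite inf0.
  by apply: lb_le_inf => // _ [u _ <-]; exact: cut_dist_ge0.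
have Dle r : D r -> 0 <= r <= eps.
  move=> [x mx <-]; rewrite inf0 /=.
  have [g Vg xg] := KP _ mx; apply: le_trans xg.
  rewrite -[x in rcut_dist_set x _]reprK -(cut_dist_pi (repr x) g).
  apply: ge_inf; last by exists (\pi_(rgraphon R) g)%qT => //; exists g.
  by exists 0 => _ [u _ <-]; exact: cut_dist_ge0.
have [->|/set0P[r Dr]] := eqVneq D set0; first by rewrite sup0 normr0 ltW.
have ubD : ubound D eps by move=> s /Dle/andP[].
rewrite ger0_norm; first by apply: ge_sup => //; exists r.
have /andP[r0 _] := Dle _ Dr; apply: le_trans r0 _.
by apply: sup_upper_bound => //; split; [exists r|exists eps].
Qed.

(** * Scalar inequalities locating a maximizer *)

Section PhaseInequalities.
Variables (a b beta2 kappa e p S : R).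
Hypotheses (e01 : 0 <= e <= 1) (p0 : 0 <= p) (S02 : 0 <= S <= 2).
Hypothesis beta20 : beta2 < 0.
Hypothesis large : `|b| + 2 <= - beta2 * kappa.
Hypothesis gap : 0 <= 2 * e - 1 ->
  (2 * e - 1) + (2 * e - 1) * (1 - (2 * e - 1)) / 6 <= p.

Let beta1 := a * beta2 + b.

Lemma goodman_pow : 2 * e - 1 <= p.
Proof.
have [w0|w0] := leP 0 (2 * e - 1); last by apply: le_trans p0; exact: ltW.
apply: le_trans (gap w0); rewrite lerDl divr_ge0// mulr_ge0//.
by move: e01 => /andP[? ?]; lra.
Qed.

(** Dividing by - beta2 leaves b (e - 1/2) + S as error: at most |b| + 2, which [large] turns into
    [kappa]. *)
Lemma optimality_bip : beta1 / 2 <= beta1 * e + beta2 * p + S ->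
  p + a * (e - 1 / 2) <= kappa.
Proof.
move: e01 S02 => /andP[e0 e1] /andP[S0 S2] H.
have bn : 0 < - beta2 by rewrite oppr_gt0.
rewrite -(ler_pM2l bn); apply: le_trans large.
have : b * (e - 1 / 2) <= `|b|.
  apply: le_trans (ler_norm _) _; rewrite normrM ler_piMr//.
  by rewrite ler_norml; lra.
by move: H; rewrite /beta1; lra.
Qed.

Lemma optimality_const1 : beta1 + beta2 <= beta1 * e + beta2 * p + S ->
  p - 1 + a * (e - 1) <= kappa.
Proof.
move: e01 S02 => /andP[e0 e1] /andP[S0 S2] H.
have bn : 0 < - beta2 by rewrite oppr_gt0.
rewrite -(ler_pM2l bn); apply: le_trans large.
have : b * (e - 1) <= `|b|.
  apply: le_trans (ler_norm _) _; rewrite normrM ler_piMr//.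
  by rewrite ler_norml; lra.
by move: H; rewrite /beta1; lra.
Qed.

(** For e >= 1/2, p >= 2 e - 1 bounds the left side below by (1 + a/2) p; for e < 1/2 both of its
    terms are nonnegative and so are each at most [kappa]. *)
Lemma phase_bip delta : -2 < a -> a < 0 -> 0 < kappa ->
  kappa <= delta * (1 + a / 2) -> kappa <= delta * - a ->
  p + a * (e - 1 / 2) <= kappa -> 1 / 2 - delta <= e /\ p <= delta.
Proof.
move=> a2 a0 k0 k1 k2 H; have W := goodman_pow; have c0 : 0 < 1 + a / 2 by lra.
have d0 : 0 < delta by rewrite -(pmulr_lgt0 _ c0); exact: lt_le_trans k1.
have na : 0 < - a by rewrite oppr_gt0.
have [e2|e2] := leP (1 / 2) e.
  split; first by apply: le_trans e2; lra.
  rewrite -(ler_pM2r c0); apply: le_trans k1; apply: le_trans H.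
  have : 0 <= - a * (p - (2 * e - 1)) by rewrite mulr_ge0// ?subr_ge0// ltW.
  by lra.
have ae : 0 <= - a * (1 / 2 - e) by rewrite mulr_ge0//; lra.
split.
  suff : 1 / 2 - e <= delta by lra.
  by rewrite -(ler_pM2l na); move: k2 H p0; lra.
have : delta * (1 + a / 2) <= delta * 1.
  by apply: ler_wpM2l; lra.
by move: k1 H ae; lra.
Qed.

Lemma phase_const1 delta : a < -2 -> kappa <= delta * (- a - 2) ->
  p - 1 + a * (e - 1) <= kappa -> 1 - delta <= e.
Proof.
move=> a2 k1 H; have W := goodman_pow; have c0 : 0 < - a - 2 by lra.
suff : 1 - e <= delta by lra.
by rewrite -(ler_pM2r c0); apply: le_trans k1; apply: le_trans H; move: W; lra.
Qed.

(** With w = 2 e - 1, the gap forces w (1 - w) <= 6 kappa, whereas delta/2 < w < 1 - delta would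
    make it at least delta^2 / 2. *)
Lemma phase_critical delta : 0 < delta -> 0 < kappa -> kappa <= delta / 2 ->
  12 * kappa < delta ^+ 2 -> p <= 2 * e - 1 + kappa ->
  [/\ 1 / 2 - delta <= e, e <= 1 / 2 + delta & p <= delta] \/ 1 - delta <= e.
Proof.
move=> d0 k0 k1 k2 H; have W := goodman_pow; move: e01 => /andP[e0 e1].
have [w0|w0] := leP 0 (2 * e - 1); last first.
  by left; move: p0 => ?; split; lra.
have G := gap w0; have [w1|w1] := leP (2 * e - 1) (delta / 2).
  by left; split; lra.
have [w2|w2] := leP (1 - delta) (2 * e - 1); first by right; lra.
exfalso.
have : delta / 2 * delta <= (2 * e - 1) * (1 - (2 * e - 1)).
  by apply: ler_pM; lra.
by rewrite expr2 in k2; lra.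
Qed.

End PhaseInequalities.
End Maximizers.

Theorem theorem4p3 (R : realType) (gamma a b : R) :
  0 < gamma -> gamma <= 5 / 9 -> a < 0 ->
  [/\ a > -2 \/ (a = -2 /\ b < 0) ->
        max_cut_dist gamma (a * beta2 + b) beta2 [set turan 2]
          @[beta2 --> -oo] --> 0,
      a = -2 /\ b = 0 ->
        max_cut_dist gamma (a * beta2 + b) beta2 [set turan 2; const1]
          @[beta2 --> -oo] --> 0 &
      a < -2 \/ (a = -2 /\ b > 0) ->
        max_cut_dist gamma (a * beta2 + b) beta2 [set const1]
          @[beta2 --> -oo] --> 0].
Proof.
move=> gamma0 gamma59 a0.
have largeP kappa beta2 : 0 < kappa -> (`|b| + 2) / kappa <= - beta2 ->
    beta2 < 0 /\ `|b| + 2 <= - beta2 * kappa.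
  move=> k0 kb; rewrite -ler_pdivrMr//; split=> //.
  by rewrite -oppr_gt0; apply: lt_le_trans kb; rewrite divr_gt0// ltr_wpDl.
have S02 (x : rgraphon R) : 0 <= red_entropy x <= 2.
  by rewrite red_entropy_ge0 red_entropy_le2.
(* Each alternative records the comparison with the opposite candidate, so that the sign of [b] can
   rule it out. *)
have critical (eps : R) : a = -2 -> 0 < eps ->
    exists K, forall beta2, K <= - beta2 ->
    forall x, maximizers gamma (a * beta2 + b) beta2 x ->
    [/\ cut_dist (repr x) (turan 2) <= eps, red_entropy x <= eps,
        red_edge x <= 3 / 4 & 0 <= b * (red_edge x - 1) + red_entropy x] \/
    [/\ cut_dist (repr x) const1 <= eps, red_entropy x <= eps,
        3 / 4 <= red_edge x & 0 <= b * (red_edge x - 1 / 2) + red_entropy x].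
  move=> a2 eps0.
  have [d1 d10 d1P] := near_turan2 eps0; have [d2 d20 d2P] := near_const1 eps0.
  (* The cap 1/4 separates the two regimes at edge density 3/4. *)
  pose d : R := Num.min (1 / 4) (Num.min d1 d2).
  have d0 : 0 < d by rewrite !lt_min d10 d20 divr_gt0.
  have dd1 : d <= d1 by rewrite !ge_min lexx /= orbT.
  have dd2 : d <= d2 by rewrite !ge_min lexx /= !orbT.
  have d4 : d <= 1 / 4 by rewrite !ge_min lexx.
  pose kappa := d ^+ 2 / 13.
  have k0 : 0 < kappa by rewrite divr_gt0// exprn_gt0.
  have k1 : kappa <= d / 2 by rewrite /kappa expr2; nra.
  have k2 : 12 * kappa < d ^+ 2.
    by have := exprn_gt0 2 d0; rewrite /kappa; lra.
  exists ((`|b| + 2) / kappa) => beta2 /(largeP _ _ k0)[b20 large] x mx.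
  have gap := @red_tri_gap _ _ gamma0 gamma59 x.
  have e01 := red_edge_itv x.
  have p0 : 0 <= red_tri x `^ gamma by exact: powR_ge0.
  have obip := maximizer_ge_bip gamma0 gamma59 mx.
  have ocst := maximizer_ge_const1 gamma0 gamma59 (ltW b20) mx.
  have H := optimality_bip e01 (S02 x) b20 large obip.
  have W := goodman_pow e01 p0 gap.
  have nb : 0 < - beta2 by rewrite oppr_gt0.
  (* At a = -2 this is the whole contribution of order beta2 in both comparisons; its sign lets it
     be dropped, leaving the O(1) terms. *)
  have Wb : 0 <= - beta2 * (red_tri x `^ gamma - (2 * red_edge x - 1)).
    by rewrite mulr_ge0// ?subr_ge0// ltW.
  have ob : 0 <= b * (red_edge x - 1 / 2) + red_entropy x.
    by move: obip; rewrite a2; lra.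
  have oc : 0 <= b * (red_edge x - 1) + red_entropy x.
    by move: ocst; rewrite a2; lra.
  have /andP[tp _] := red_tri_pow_itv gamma0 gamma59 x.
  have H' : red_tri x `^ gamma <= 2 * red_edge x - 1 + kappa.
    by move: H; rewrite a2; lra.
  have [[ex ex' px]|ex] := phase_critical e01 p0 gap d0 k0 k1 k2 H'.
    left; have [] := d1P (repr x); rewrite -/(red_edge x) -/(red_tri x); [lra|lra|].
    by move=> ? ?; split=> //; lra.
  right; have [] := d2P (repr x); rewrite -/(red_edge x); first by lra.
  by move=> ? ?; split=> //; lra.
split.
- move=> h; apply: (max_cut_dist_cvg0) => // eps eps0.
  case: h => [a2|[a2 b0]].
    have [d d0 dP] := near_turan2 eps0.
    have c0 : 0 < 1 + a / 2 by lra.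
    have na : 0 < - a by rewrite oppr_gt0.
    pose kappa := Num.min (d * (1 + a / 2)) (d * - a).
    have k0 : 0 < kappa by rewrite lt_min !mulr_gt0.
    have k1 : kappa <= d * (1 + a / 2) by rewrite ge_min lexx.
    have k2 : kappa <= d * - a by rewrite ge_min lexx orbT.
    exists ((`|b| + 2) / kappa) => beta2 /(largeP _ _ k0)[b20 large] x mx.
    have gap := @red_tri_gap _ _ gamma0 gamma59 x; have e01 := red_edge_itv x.
    have p0 : 0 <= red_tri x `^ gamma by exact: powR_ge0.
    have H := optimality_bip e01 (S02 x) b20 large (maximizer_ge_bip gamma0 gamma59 mx).
    have [ex px] := phase_bip e01 p0 gap a2 a0 k0 k1 k2 H.
    have /andP[tp _] := red_tri_pow_itv gamma0 gamma59 x.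
    exists (turan 2) => //.
    by have [] := dP (repr x) ex (le_trans tp px).
  (* In the constant regime e >= 3/4 makes b (e - 1/2) <= b / 4, which an entropy of at most - b / 8
     cannot offset. *)
  pose eps' := Num.min eps (- b / 8).
  have e'0 : 0 < eps' by rewrite lt_min eps0 divr_gt0// oppr_gt0.
  have e'1 : eps' <= eps by rewrite ge_min lexx.
  have e'2 : eps' <= - b / 8 by rewrite ge_min lexx orbT.
  have [K KP] := critical eps' a2 e'0; exists K => beta2 /KP {}KP x /KP.
  move=> [[xT _ _ _]|[_ Sx ex bx]]; first by exists (turan 2) => //;
    exact: le_trans e'1.
  by exfalso; nra.
- move=> [a2 b0]; apply: max_cut_dist_cvg0 => // eps eps0.
  have [K KP] := critical eps a2 eps0; exists K => beta2 /KP {}KP x /KP.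
  by move=> [[? _ _ _]|[? _ _ _]]; [exists (turan 2) => //; left|exists const1 => //;
    right].
- move=> h; apply: max_cut_dist_cvg0 => // eps eps0.
  case: h => [a2|[a2 b0]].
    have [d d0 dP] := near_const1 eps0.
    have c0 : 0 < - a - 2 by lra.
    pose kappa := d * (- a - 2).
    have k0 : 0 < kappa by rewrite mulr_gt0.
    exists ((`|b| + 2) / kappa) => beta2 /(largeP _ _ k0)[b20 large] x mx.
    have gap := @red_tri_gap _ _ gamma0 gamma59 x; have e01 := red_edge_itv x.
    have p0 : 0 <= red_tri x `^ gamma by exact: powR_ge0.
    have H := optimality_const1 e01 (S02 x) b20 large
      (maximizer_ge_const1 gamma0 gamma59 (ltW b20) mx).
    exists const1 => //.
    by have [] := dP (repr x) (phase_const1 e01 p0 gap a2 (lexx _) H).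
  (* Symmetrically, e <= 3/4 makes b (e - 1) <= - b / 4 in the bipartite regime. *)
  pose eps' := Num.min eps (b / 8).
  have e'0 : 0 < eps' by rewrite lt_min eps0 divr_gt0.
  have e'1 : eps' <= eps by rewrite ge_min lexx.
  have e'2 : eps' <= b / 8 by rewrite ge_min lexx orbT.
  have [K KP] := critical eps' a2 e'0; exists K => beta2 /KP {}KP x /KP.
  move=> [[_ Sx ex bx]|[x1 _ _ _]]; last by exists const1 => //; exact: le_trans e'1.
  by exfalso; nra.
Qed.
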